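(* Let $k \geqslant 4$ be a fixed integer. For all odd integers $n \geqslant 3$ and all integers $m \geqslant 1$ with $(m,n)=1$, $$S_k(n,m) = 2^{-k} n^k \varphi(n)^{k-1} + O\left( n^{\frac{3}{2}(k-2)} \varphi(n)^3 (\log n)^{k-4} (\log\log n)^2 \right),$$ where the implied constant depends at most on $k$ (and not on $n$ or $m$).
   Context: $(a,b)$ denotes the greatest common divisor, $\varphi$ is Euler's totient function, and $\log$ is the natural logarithm. For integers $k \geqslant 2$, $n \geqslant 2$, $m \geqslant 1$ with $(m,n)=1$, $$S_k(n,m) := \sum_{\substack{1 \leqslant a_1,\dots,a_k \leqslant n \\ a_1 \cdots a_k \equiv m \ (\mathrm{mod}\ n)}} a_1 \cdots a_k ,$$ with the convention that only tuples with $(a_j,n)=1$ for all $j$ contribute (this is automatic because $(m,n)=1$). *)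

(* Defs.v *)
From mathcomp Require Import all_boot all_order all_algebra.
From mathcomp Require Import reals exp.
Set Implicit Arguments.
Unset Strict Implicit.
Unset Printing Implicit Defensive.

Local Open Scope nat_scope.

(* S_k(n, m). A tuple (a_1, ..., a_k) with 1 <= a_j <= n is a function from
   'I_k to 'I_n.+1 = {0, ..., n} with nonzero values. The coprimality condition
   is the convention on contributing tuples; when m is coprime to n it already
   follows from the congruence. *)
Definition S_sum (k n m : nat) : nat :=
  \sum_(a : {ffun 'I_k -> 'I_n.+1} |
          [forall j, (0 < a j) && coprime (a j) n]
          && (\prod_(j < k) a j == m %[mod n]))
     \prod_(j < k) a j.

Local Open Scope ring_scope.

Definition main_term (R : realType) (k n : nat) : R :=
  2 ^- k * n%:R ^+ k * (totient n)%:R ^+ (k - 1).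

(* The exponent 3/2 * (k - 2) need not be an integer, hence the real power;
   the exponent k - 4 is a truncated subtraction on nat, used for 4 <= k. *)
Definition error_term (R : realType) (k n : nat) : R :=
  n%:R `^ (3 / 2 * (k%:R - 2)) * (totient n)%:R ^+ 3
  * ln n%:R ^+ (k - 4) * ln (ln n%:R) ^+ 2.

(* Main.v *)
Require Import Defs.
From mathcomp Require Import all_boot all_order all_algebra.
From mathcomp Require Import fingroup cyclic algC cyclotomic classfun character.
From mathcomp Require Import topology normedtype derive.
From mathcomp Require Import reals sequences exp trigo.
From mathcomp Require Import complex.
From mathcomp Require Import ring lra zify.

(** Summing over characters modulo n, orthogonality turns the congruence into
    phi(n) S_k(n,m) = sum over chi of conj(chi(m)) B_chi^k, where B_chi is the
    sum of a chi(a) over a <= n ([S_sum_moments]).  For the principal character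
    the pairing of a with n - a gives B = n phi(n) / 2, and its contribution is
    exactly the main term.  For every other character B_chi = n beta_chi, where
    beta_chi sums the sawtooth a/n - 1/2 against chi.  The error is therefore
    at most n^k / phi(n) times the sum of |beta_chi|^k, and it suffices to
    estimate the largest |beta_chi| and the fourth moment:
    |beta_chi| << sqrt(n) log n ([polya_vinogradov]), and
    the sum of |beta_chi|^4 is << n phi(n)^2 ([fourth_moment]).
    The elementary bound n << phi(n) log log n ([totient_lower_bound]) then
    trades the surplus n^2 for phi(n)^2 (log log n)^2.

    Both estimates go by descent on the modulus.  If chi is induced by a
    character rho modulo q = n/p, then beta_chi = (1 - rho(p)) beta_rho
    ([beta_lower]): at most a factor 2 is lost for |beta|, and 16 for the fourth
    moment, while the passage from q to n gains at least sqrt(p), respectively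
    p (p-1)^2.  Since n is odd only p = 3 costs more than it gains, and as a
    factor 2 appears only when p does not divide q this happens once; a weight
    that sees whether 3 divides n absorbs it.

    For a primitive chi, Fourier expansion of the sawtooth and separability of
    Gauss sums give beta_chi = tau(chi) * sum of c_j conj(chi(j)) with
    |c_j| <= 1/j for j <= n/2 ([beta_gauss], [saw_bound]); as
    |tau(chi)| <= sqrt(n), the pointwise bound is immediate.  The fourth moment
    needs a saving of phi(n)/n over what orthogonality of all characters yields.
    Split the sum over j at y close to n^(1/16).  For j, l <= y the identity
    tau(chi) conj(chi(jl)) = sum of chi(a) e(ajl/n) lets Bessel's inequality
    reduce the moment to a mean square over the phi(n) residues prime to n;
    Ramanujan sums are small, so that only the diagonal jl = j'l' matters, and it
    contributes O(phi(n)) ([coprime_mean_square], [diagonal_sum],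
    [short_moment]).  The terms with j > y save a power of n
    ([tail_moment]). *)

Set Implicit Arguments.
Unset Strict Implicit.
Unset Printing Implicit Defensive.
Import Order.TTheory GRing.Theory Num.Theory numFieldNormedType.Exports.
Import Normc.
Local Open Scope complex_scope.
Local Open Scope ring_scope.

(** * Modulus of complex numbers *)

Section ComplexModulus.
Variable R : realType.
Implicit Types (z w : R[i]) (x : R).

Lemma normc_ge0 z : 0 <= normc z.
Proof. by case: z => a b; exact: sqrtr_ge0. Qed.

Lemma normc_sum (I : Type) (r : seq I) (P : pred I) (F : I -> R[i]) :
  normc (\sum_(i <- r | P i) F i) <= \sum_(i <- r | P i) normc (F i).
Proof.
elim/big_rec2: _ => [|i y z Pi le_zy]; first by rewrite normc0.
by apply: le_trans (le_normcD _ _) _; rewrite lerD2l.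
Qed.

Lemma normcX z n : normc (z ^+ n) = normc z ^+ n.
Proof. by elim: n => [|n IHn]; rewrite ?expr0 ?normc1 // !exprS normcM IHn. Qed.

Lemma normc_conj z : normc z^* = normc z.
Proof. by apply: complexI; exact: (norm_conjC z). Qed.

Lemma normc_real x : normc x%:C = `|x|.
Proof. by rewrite /= expr0n addr0 sqrtr_sqr. Qed.

Lemma normc_nat n : normc (n%:R : R[i]) = n%:R.
Proof. by rewrite -(rmorph_nat (real_complex R)) normc_real normr_nat. Qed.

Lemma sqr_normcE z : (normc z ^+ 2)%:C = z * z^*.
Proof. by rewrite rmorphXn; exact: (normCK z). Qed.

Lemma conjC_real x : (x%:C : R[i])^* = x%:C.
Proof. by apply: conj_Creal; apply/complex_realP; exists x. Qed.

Lemma normc_unity z n : (0 < n)%N -> z ^+ n = 1 -> normc z = 1.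
Proof.
move=> n0 zn; apply/eqP; rewrite -(@pexpr_eq1 _ _ n) ?normc_ge0 //.
by rewrite -normcX zn normc1.
Qed.

Lemma conj_unity z : normc z = 1 -> z * z^* = 1.
Proof. by move=> z1; rewrite -sqr_normcE z1 expr1n. Qed.

End ComplexModulus.

(** * Additive characters modulo n *)

Section AdditiveCharacters.
Variable R : realType.

Lemma sin_le_id (x : R) : 0 <= x -> sin x <= x.
Proof.
rewrite le_eqVlt => /predU1P[<-|x0]; first by rewrite sin0.
have [c _] := @MVT _ (@sin R) cos 0 x x0 (fun c _ => is_derive_sin c)
  (continuous_subspaceT (@continuous_sin R)).
rewrite sin0 !subr0 => ->; rewrite ler_piMl ?cos_le1 //; exact: ltW.
Qed.

Lemma cos1_ge_half : 1 / 2 <= cos 1 :> R.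
Proof.
have -> : 1 = (1 / 2) *+ 2 :> R by lra.
rewrite cos_mulr2n cos2sin2.
have s1 : sin (1 / 2) <= 1 / 2 :> R by apply: sin_le_id; lra.
have s0 : 0 <= sin (1 / 2) :> R.
  by apply: sin_ge0_pi; have := pi_ge2 R; lra.
have : sin (1 / 2) ^+ 2 <= (1 / 2) ^+ 2 :> R by rewrite lerXn2r ?nnegrE //; lra.
lra.
Qed.

(** On [0, 1] the mean value theorem gives slope at least cos 1 >= 1/2; on
    [1, pi/2] monotonicity suffices, because pi/2 < 2. *)
Lemma sin_ge_quarter (x : R) : 0 <= x -> x <= pi / 2 -> x / 4 <= sin x.
Proof.
have p2 := @pihalf_lt2 R; have p1 := @pihalf_ge1 R; have c1 := cos1_ge_half.
have low (y : R) : 0 <= y -> y <= 1 -> y / 2 <= sin y.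
  rewrite le_eqVlt => /predU1P[<-|y0 y1]; first by rewrite sin0 mul0r.
  have [c] := @MVT _ (@sin R) cos 0 y y0 (fun c _ => is_derive_sin c)
    (continuous_subspaceT (@continuous_sin R)).
  rewrite in_itv /= sin0 !subr0 => /andP[c0 cy] ->; rewrite mulrC ler_pM2r //.
  have := @pi_ge2 R => pi2.
  suff : cos 1 <= cos c by lra.
  rewrite leNgt ltr_cos ?in_itv /=; [|lra|lra].
  by rewrite -leNgt; lra.
move=> x0 xp; have [x1|x1] := lerP x 1; first by have := low x x0 x1; lra.
have := low 1 ler01 (lexx _).
suff : sin 1 <= sin x by lra.
rewrite leNgt ltr_sin ?in_itv /=; [|lra|lra].
by rewrite -leNgt; lra.
Qed.

(** The value exp (2 i pi j / n). *)
Definition adc (n j : nat) : R[i] :=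
  let t := pi *+ 2 * j%:R / n%:R in cos t +i* sin t.

Lemma adc0 n : adc n 0 = 1.
Proof. by rewrite /adc mulr0 mul0r cos0 sin0. Qed.

Lemma adcD n j l : adc n (j + l) = adc n j * adc n l.
Proof.
rewrite /adc natrD mulrDr mulrDl cosD sinD.
by apply/eqP; rewrite eq_complex /= eqxx addrC [X in X + _]mulrC [X in _ + X]mulrC addrC eqxx.
Qed.

Lemma adcM n j l : adc n (j * l) = adc n j ^+ l.
Proof. by elim: l => [|l IHl]; rewrite ?muln0 ?adc0 // mulnS adcD IHl exprS. Qed.

Lemma adcnn n : (0 < n)%N -> adc n n = 1.
Proof.
move=> n0; rewrite /adc mulfK ?pnatr_eq0 -?lt0n //.
by rewrite cos2pi sin2pi.
Qed.

Lemma adc_mod n j : (0 < n)%N -> adc n (j %% n) = adc n j.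
Proof.
move=> n0; rewrite [in RHS](divn_eq j n) adcD mulnC adcM adcnn // expr1n.
by rewrite mul1r.
Qed.

Lemma adc_unit n j : adc n j * (adc n j)^* = 1.
Proof.
rewrite -sqr_normcE /= sqr_sqrtr ?addr_ge0 ?sqr_ge0 //.
by rewrite cos2Dsin2.
Qed.

Lemma adc_compl n j : (0 < n)%N -> (j <= n)%N -> adc n (n - j) = (adc n j)^*.
Proof.
move=> n0 jn; have e1 : adc n j * adc n (n - j) = 1.
  by rewrite -adcD subnKC ?adcnn.
apply: (@mulfI _ (adc n j)); last by rewrite e1 adc_unit.
by apply: contra_eq_neq e1 => ->; rewrite mul0r eq_sym oner_eq0.
Qed.

(** The chord |exp (2 i pi j / n) - 1| is 2 sin (pi j / n), and pi >= 2. *)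
Lemma adc_dist n j : (0 < n)%N -> (j.*2 <= n)%N ->
  j%:R <= n%:R * normc (adc n j - 1) :> R.
Proof.
move=> n0 jn; have n0' : 0 < n%:R :> R by rewrite ltr0n.
set x : R := pi * j%:R / n%:R.
have x0 : 0 <= x by rewrite !mulr_ge0 ?pi_ge0 ?invr_ge0.
have xp : x <= pi / 2.
  rewrite /x ler_pdivrMr // mulrAC ler_pdivlMr // -mulrA ler_pM2l ?pi_gt0 //.
  by rewrite -natrM muln2 ler_nat.
have s0 := sin_ge_quarter x0 xp.
have -> : normc (adc n j - 1) = 2 * sin x.
  rewrite /adc (_ : pi *+ 2 * _ / _ = x *+ 2); last by rewrite /x; ring.
  rewrite cos_mulr2n sin_mulr2n /=.
  rewrite -[RHS]ger0_norm; last lra.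
  rewrite -sqrtr_sqr; congr Num.sqrt.
  have := cos2Dsin2 x; set c := cos x; set s := sin x => cs.
  have -> : c ^+ 2 = 1 - s ^+ 2 by rewrite -cs; ring.
  rewrite oppr0 addr0.
  transitivity (4 * s ^+ 4 + 4 * c ^+ 2 * s ^+ 2); first by ring.
  have -> : c ^+ 2 = 1 - s ^+ 2 by rewrite -cs; ring.
  ring.
apply: (@le_trans _ _ (n%:R * (x / 2))); last by rewrite ler_pM2l //; lra.
rewrite /x mulrA [n%:R * _]mulrCA divff ?gt_eqF // mulr1 -mulrAC.
have := @pi_ge2 R; have : 0 <= j%:R :> R by [].
nra.
Qed.

Lemma adc_eq1 n j : (0 < n)%N -> (adc n j == 1) = (n %| j)%N.
Proof.
move=> n0; apply/eqP/idP => [|/dvdnP[k ->]]; last first.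
  by rewrite mulnC adcM adcnn // expr1n.
rewrite -adc_mod // /dvdn; move: (ltn_pmod j n0); move: (j %% n)%N => {}j jn.
move=> e1; apply/eqP.
wlog j2 : j jn e1 / (j.*2 <= n)%N.
  move=> IH; have [/IH->//|nj] := leqP j.*2 n.
  have : adc n (n - j) = 1 by rewrite adc_compl ?e1 ?conjC1 // ltnW.
  by move=> /IH; lia.
have := adc_dist n0 j2; rewrite e1 subrr normc0 mulr0 lern0.
by move/eqP.
Qed.

Lemma adc_sum n j : (0 < n)%N ->
  \sum_(a < n) adc n (j * a) = if (n %| j)%N then n%:R else 0.
Proof.
move=> n0; under eq_bigr do rewrite adcM; rewrite -adc_eq1 //.
case: eqP => [->|/eqP ne1].
  by under eq_bigr do rewrite expr1n; rewrite sumr_const card_ord.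
have /eqP : adc n j ^+ n - 1 = 0.
  by rewrite -adcM mulnC adcM adcnn // expr1n subrr.
by rewrite subrX1 mulf_eq0 subr_eq0 (negPf ne1) => /eqP.
Qed.

End AdditiveCharacters.

(** * Bessel's inequality *)

(** The squared distance of M g from the span of the (e i)^*, expanded.  Besides
    Bessel's inequality it gives completeness of a family, as soon as the
    right-hand side can be seen to vanish. *)
Lemma bessel_defect (R : realType) (I J : finType) (P : pred I) (M : R)
    (e : I -> J -> R[i]) (g : J -> R[i]) :
    (forall i j, P i -> P j ->
      \sum_x e i x * (e j x)^* = if i == j then M%:C else 0) ->
  \sum_x normc (M%:C * g x -
      \sum_(i | P i) (\sum_y g y * e i y) * (e i x)^*) ^+ 2 =
  M * (M * \sum_x normc (g x) ^+ 2
       - \sum_(i | P i) normc (\sum_x g x * e i x) ^+ 2).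
Proof.
move=> orth; pose c i := \sum_x g x * e i x.
pose S := \sum_(i | P i) normc (c i) ^+ 2; rewrite -/S.
pose G := \sum_x normc (g x) ^+ 2; rewrite -/G.
pose p x := \sum_(i | P i) c i * (e i x)^*.
have gp : \sum_x g x * (p x)^* = S%:C.
  under eq_bigr do rewrite rmorph_sum mulr_sumr.
  rewrite exchange_big rmorph_sum; apply: eq_bigr => i _ /=.
  rewrite sqr_normcE mulrC /c mulr_sumr; apply: eq_bigr => x _.
  by rewrite rmorphM /= conjCK; ring.
have pp : \sum_x p x * (p x)^* = (M * S)%:C.
  under eq_bigr do rewrite rmorph_sum mulr_sumr.
  rewrite exchange_big rmorphM /= rmorph_sum mulr_sumr.
  apply: eq_bigr => i Pi /=.
  transitivity ((c i)^* * \sum_x \sum_(j | P j) c j * (e i x * (e j x)^*)).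
    rewrite mulr_sumr; apply: eq_bigr => x _.
    rewrite rmorphM /= conjCK mulr_suml mulr_sumr; apply: eq_bigr => j _; ring.
  rewrite exchange_big (bigD1 i) //= -mulr_sumr orth // eqxx.
  rewrite [X in _ + X]big1 ?addr0 => [|j /andP[Pj ji]]; last first.
    by rewrite -mulr_sumr orth // eq_sym (negPf ji) mulr0.
  by rewrite sqr_normcE; ring.
have gg : \sum_x g x * (g x)^* = G%:C.
  by rewrite rmorph_sum; apply: eq_bigr => x _; rewrite /= sqr_normcE.
have pg : \sum_x p x * (g x)^* = S%:C.
  rewrite -[RHS]conjCK conjC_real -gp rmorph_sum; apply: eq_bigr => x _.
  by rewrite /= rmorphM /= conjCK mulrC.
apply: complexI; rewrite rmorph_sum /=.
transitivity (\sum_x (M%:C * M%:C * (g x * (g x)^*) - M%:C * (g x * (p x)^*)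
   - M%:C * (p x * (g x)^*) + p x * (p x)^*)).
  apply: eq_bigr => x _; rewrite sqr_normcE rmorphB rmorphM /= conjC_real -/(p x).
  by rewrite rmorph_sum; ring.
rewrite big_split /= !sumrB -!mulr_sumr gg gp pg pp.
by rewrite !rmorphM /= rmorphB rmorphM /=; ring.
Qed.

Lemma bessel (R : realType) (I J : finType) (P : pred I) (M : R)
    (e : I -> J -> R[i]) (g : J -> R[i]) :
    0 < M ->
    (forall i j, P i -> P j ->
      \sum_x e i x * (e j x)^* = if i == j then M%:C else 0) ->
  \sum_(i | P i) normc (\sum_x g x * e i x) ^+ 2
    <= M * \sum_x normc (g x) ^+ 2.
Proof.
move=> M0 orth; rewrite -subr_ge0 -(pmulr_rge0 _ M0) -(bessel_defect g orth).
by apply: sumr_ge0 => x _; rewrite sqr_ge0.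
Qed.

(** * Dirichlet characters and induction *)

Lemma prime_not_coprime p a b :
  prime p -> (p %| a)%N -> (p %| b)%N -> ~~ coprime a b.
Proof.
move=> p_pr pa pb; apply/negP => /(coprime_dvdl pa).
by rewrite prime_coprime // pb.
Qed.

Lemma eqn_mod_unitl n u a b : coprime u n ->
  (u * a == u * b %[mod n]) = (a == b %[mod n]).
Proof.
move=> un; wlog ab : a b / (a <= b)%N => [IH|].
  by have [/IH//|/ltnW/IH IH'] := leqP a b; rewrite eq_sym IH' eq_sym.
rewrite eq_sym [RHS]eq_sym !eqn_mod_dvd ?leq_mul2l ?ab ?orbT //.
by rewrite -mulnBr Gauss_dvdr // coprime_sym.
Qed.

Lemma big_unit_mul (V : nmodType) (n u : nat) (F : nat -> V) :
  (0 < n)%N -> coprime u n ->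
  \sum_(a < n) F (u * a %% n)%N = \sum_(a < n) F a.
Proof.
case: n => // n _ un.
have inj : injective (fun a : 'I_n.+1 => inord (u * a %% n.+1) : 'I_n.+1).
  move=> a b /(congr1 val) /=; rewrite !inordK ?ltn_pmod // => /eqP.
  rewrite eqn_mod_unitl // !modn_small //.
  by move/eqP/val_inj.
rewrite [RHS](reindex_inj inj) /=; apply: eq_bigr => a _.
by rewrite inordK // ltn_pmod.
Qed.

Section DirichletCharacters.
Variable R : realType.
Implicit Types (n a b : nat) (chi rho : nat -> R[i]).

(** Characters are functions on nat, so that a character modulo n and the
    characters that induce it live in the same type. *)
Definition dchar n chi :=
  [/\ chi 1%N = 1, forall a b, chi (a * b)%N = chi a * chi b,
      forall a, chi (a %% n)%N = chi a &
      forall a, ~~ coprime a n -> chi a = 0].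

(** By Euler's theorem the values at units are roots of unity. *)
Lemma dchar_norm n chi a : dchar n chi -> (0 < n)%N -> coprime a n ->
  normc (chi a) = 1.
Proof.
move=> [c1 cM cm _] n0 an; apply: (@normc_unity _ _ (totient n)).
  by rewrite totient_gt0.
have cX k : chi (a ^ k)%N = chi a ^+ k.
  by elim: k => [|k IH]; rewrite ?expn0 // expnS cM IH exprS.
by rewrite -cX -cm Euler_exp_totient // cm.
Qed.

Lemma dchar_norm_le1 n chi a : dchar n chi -> (0 < n)%N -> normc (chi a) <= 1.
Proof.
move=> chiD n0; have [an|na] := boolP (coprime a n).
  by rewrite (dchar_norm chiD).
by case: chiD => _ _ _ ->; rewrite // normc0.
Qed.

Lemma dchar_conj n chi a : dchar n chi -> (0 < n)%N -> coprime a n ->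
  chi a * (chi a)^* = 1.
Proof. by move=> chiD n0 an; rewrite conj_unity // (dchar_norm chiD). Qed.

Lemma dchar_modP n chi a b : dchar n chi -> a = b %[mod n] -> chi a = chi b.
Proof. by case=> _ _ cm _ ab; rewrite -cm ab cm. Qed.

Lemma sum_coprime n : \sum_(a < n) (coprime a n)%:R = (totient n)%:R :> R.
Proof.
rewrite totient_count_coprime natr_sum big_mkord.
by apply: eq_bigr => a _; rewrite coprime_sym.
Qed.

Lemma dchar_sum_sqr n chi : dchar n chi -> (0 < n)%N ->
  \sum_(a < n) chi a * (chi a)^* = (totient n)%:R.
Proof.
move=> chiD n0; rewrite -[RHS](rmorph_nat (real_complex R)) -sum_coprime.
rewrite rmorph_sum; apply: eq_bigr => a _ /=; rewrite rmorph_nat.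
have [an|na] := boolP (coprime a n); first by rewrite (dchar_conj chiD).
by case: chiD => _ _ _ ->; rewrite // mul0r.
Qed.

(** Replacing a by u a multiplies the sum by chi u * (rho u)^*, which is not 1. *)
Lemma dchar_orth n chi rho u : dchar n chi -> dchar n rho -> (0 < n)%N ->
  chi u <> rho u -> \sum_(a < n) chi a * (rho a)^* = 0.
Proof.
move=> chiD rhoD n0 neq; set T := \sum_(_ < _) _.
have un : coprime u n.
  apply: contra_notT neq => nu.
  by case: chiD rhoD => _ _ _ -> // [_ _ _ ->].
have : chi u * (rho u)^* * T = T.
  rewrite /T -[RHS](big_unit_mul (fun a => chi a * (rho a)^*) n0 un).
  rewrite mulr_sumr; apply: eq_bigr => a _.
  case: chiD => _ cM cm _; case: rhoD => _ rM rm _.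
  by rewrite cm rm cM rM rmorphM /=; ring.
move/eqP; rewrite -subr_eq0 -{2}[T]mul1r -mulrBl mulf_eq0 subr_eq0.
case/orP => [/eqP e|/eqP //]; case: neq.
have /mulfI : (rho u)^* != 0.
  apply: contra_eq_neq (dchar_conj rhoD n0 un) => ->.
  by rewrite mulr0 eq_sym oner_eq0.
by apply; rewrite mulrC e mulrC (dchar_conj rhoD).
Qed.

(** The moment bounds are stated for arbitrary finite families of distinct
    characters: this class is stable under passing to inducing characters,
    whichever characters modulo n/p occur. *)
Definition dchar_family n (I : finType) (P : pred I) (chi : I -> nat -> R[i]) :=
  (forall i, P i -> dchar n (chi i)) /\
  (forall i j, P i -> P j -> i != j -> exists a, chi i a <> chi j a).

(** Characters vanish off the units, hence only the values of g at the units
    enter on the right: this is where a factor phi(n)/n can be saved. *)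
Lemma dchar_bessel n (I : finType) (P : pred I) (chi : I -> nat -> R[i])
    (g : nat -> R[i]) : (0 < n)%N -> dchar_family n P chi ->
  \sum_(i | P i) normc (\sum_(a < n) g a * chi i a) ^+ 2
  <= (totient n)%:R * \sum_(a < n | coprime a n) normc (g a) ^+ 2.
Proof.
move=> n0 [chiD dist].
have := @bessel R I 'I_n P (totient n)%:R (fun i (a : 'I_n) => chi i a)
   (fun a : 'I_n => if coprime a n then g a else 0).
have -> : \sum_(a < n) normc (if coprime a n then g a else 0) ^+ 2 =
   \sum_(a < n | coprime a n) normc (g a) ^+ 2.
  rewrite [RHS]big_mkcond; apply: eq_bigr => a _; case: ifP => // _.
  by rewrite normc0 expr0n.
have -> : \sum_(i | P i) normc (\sum_(a < n) g a * chi i a) ^+ 2 =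
  \sum_(i | P i) normc
    (\sum_(a < n) (if coprime a n then g a else 0) * chi i a) ^+ 2.
  apply: eq_bigr => i Pi; congr (normc _ ^+ 2); apply: eq_bigr => a _.
  case: ifPn => // na; case: (chiD i Pi) => _ _ _ ->; rewrite ?mulr0 //.
apply; first by rewrite ltr0n totient_gt0.
move=> i j Pi Pj; case: eqP => [<-|/eqP ij].
  by rewrite (dchar_sum_sqr (chiD _ Pi)) // rmorph_nat.
by have [a] := dist _ _ Pi Pj ij; apply: dchar_orth (chiD _ Pi) (chiD _ Pj) n0.
Qed.

(** For nontrivial chi this is the sum of a chi(a), divided by n; the shift by 1/2
    makes the weight odd under a -> n - a. *)
Definition beta n chi : R[i] :=
  \sum_(a < n) (a%:R / n%:R - 2^-1 : R)%:C * chi a.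

(** The modulus of chi is p * q, and chi factors through the units modulo q. *)
Definition induced_from p q chi :=
  [forall u : 'I_(p * q),
    coprime u (p * q) && (u == 1 %[mod q]) ==> (chi u == 1)].

(** The character modulo q that induces chi.  If p divides a and a is prime to
    q, then a + q is prime to p, so that chi has to be read there. *)
Definition lower p q chi a : R[i] := if (p %| a)%N then chi (a + q)%N else chi a.

Section Lowering.
Variables (p q : nat) (chi : nat -> R[i]).
Hypotheses (p_pr : prime p) (q0 : (0 < q)%N).
Hypotheses (chiD : dchar (p * q) chi) (chi_ind : induced_from p q chi).

Let n0 : (0 < p * q)%N. Proof. by rewrite muln_gt0 prime_gt0. Qed.

(** The quotient of x by y is a unit modulo p * q that is 1 modulo q. *)
Lemma induced_eq x y : coprime x (p * q) -> coprime y (p * q) ->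
  x = y %[mod q] -> chi x = chi y.
Proof.
move=> xn yn xy; pose t := (y ^ (totient (p * q)).-1)%N.
have yt : (y * t = 1 %[mod p * q])%N.
  by rewrite /t -expnS prednK ?totient_gt0 // Euler_exp_totient.
have tn : coprime t (p * q) by rewrite coprimeXl.
have xt : chi (x * t)%N = 1.
  have xtn : ((x * t) %% (p * q) < p * q)%N by rewrite ltn_pmod.
  have /forallP/(_ (Ordinal xtn))/implyP /= := chi_ind.
  case: chiD => _ _ cm _; rewrite cm => H; apply/eqP; apply: H.
  rewrite coprime_modl coprimeMl xn tn /= modn_dvdm ?dvdn_mull //.
  rewrite -modnMml xy modnMml -(modn_dvdm _ (dvdn_mull p (dvdnn q))) yt.
  by rewrite modn_dvdm ?dvdn_mull.
have yt1 : chi (y * t)%N = 1.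
  by rewrite (dchar_modP chiD yt); case: chiD.
have t0 : chi t != 0.
  apply: contra_eq_neq (dchar_conj chiD n0 tn) => ->.
  by rewrite mul0r eq_sym oner_eq0.
by apply: (mulIf t0); case: chiD => _ cM _ _; rewrite -!cM xt yt1.
Qed.

Let lf a := if (p %| a)%N then (a + q)%N else a.

Let lowerE a : lower p q chi a = chi (lf a).
Proof. by rewrite /lower /lf; case: ifP. Qed.

Let lf_mod a : lf a = a %[mod q].
Proof. by rewrite /lf; case: ifP; rewrite // modnDr. Qed.

Let lf_coprime a : coprime (lf a) (p * q) = coprime a q.
Proof.
rewrite coprimeMr.
have -> : coprime (lf a) q = coprime a q.
  by rewrite -coprime_modl lf_mod coprime_modl.
have [aq|] := boolP (coprime a q); last by rewrite andbF.
rewrite andbT coprime_sym prime_coprime // /lf.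
case: (boolP (p %| a)%N) => // pa.
rewrite dvdn_addr //; apply: contraTN aq => pq.
exact: prime_not_coprime p_pr pa pq.
Qed.

Lemma lower_dchar : dchar q (lower p q chi).
Proof.
have low0 a : ~~ coprime a q -> lower p q chi a = 0.
  by move=> na; rewrite lowerE; case: chiD => _ _ _ -> //; rewrite lf_coprime.
split=> // [|a b|a].
- rewrite lowerE -(@induced_eq 1) ?coprime1n ?lf_coprime ?coprime1n ?lf_mod //.
  by case: chiD.
- have [aq|na] := boolP (coprime a q); last first.
    by rewrite (low0 a) // low0 ?mul0r // coprimeMl negb_and na.
  have [bq|nb] := boolP (coprime b q); last first.
    by rewrite (low0 b) // low0 ?mulr0 // coprimeMl negb_and nb orbT.
  have cM : chi (lf a * lf b)%N = chi (lf a) * chi (lf b) by case: chiD.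
  rewrite !lowerE -cM; apply: induced_eq.
  + by rewrite lf_coprime coprimeMl aq bq.
  + by rewrite coprimeMl !lf_coprime aq bq.
  + by rewrite lf_mod -[in RHS]modnMm !lf_mod modnMm.
- have [aq|na] := boolP (coprime a q); last by rewrite !low0 ?coprime_modl.
  rewrite !lowerE; apply: induced_eq; rewrite ?lf_coprime ?coprime_modl //.
  by rewrite !lf_mod modn_mod.
Qed.

Lemma lower_eq a : chi a = if (p %| a)%N then 0 else lower p q chi a.
Proof.
rewrite /lower; case: (boolP (p %| a)%N) => // pa.
case: chiD => _ _ _ c0; apply: c0; apply: (prime_not_coprime p_pr pa).
exact: dvdn_mulr.
Qed.

(** Off the multiples of p the character chi agrees with the character rho that
    induces it.  The full sum over a < pq collapses to beta q rho because the
    sawtooth averages along b, b + q, b + 2q, ... to the sawtooth modulo q, and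
    the multiples a = p b contribute rho(p) times the same sum. *)
Lemma beta_lower :
  beta (p * q) chi = (1 - lower p q chi p) * beta q (lower p q chi).
Proof.
have [_ rM rm r0] := lower_dchar; set rho := lower p q chi in rM rm r0 *.
have p0 : (0 < p)%N := prime_gt0 p_pr.
have p0R : p%:R != 0 :> R by rewrite pnatr_eq0 -lt0n.
have q0R : q%:R != 0 :> R by rewrite pnatr_eq0 -lt0n.
pose w a : R[i] := (a%:R / (p * q)%:R - 2^-1 : R)%:C.
transitivity (\sum_(0 <= a < p * q) w a * rho a
   - \sum_(0 <= a < p * q) (if (p %| a)%N then w a * rho a else 0)).
  rewrite -sumrB /beta -(big_mkord xpredT (fun a => w a * chi a)).
  apply: eq_bigr => a _; rewrite lower_eq -/rho; case: ifP => _.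
    by rewrite mulr0 subrr.
  by rewrite subr0.
rewrite mulrBl mul1r; congr (_ - _).
- rewrite big_nat_mul.
  transitivity (\sum_(0 <= i < p) \sum_(b < q) w (i * q + b)%N * rho b).
    apply: eq_bigr => i _.
    rewrite -{1}[(i * q)%N]add0n big_addn mulSn addnK big_mkord.
    apply: eq_bigr => b _; rewrite addnC; congr (_ * _).
    by rewrite -[LHS]rm modnMDl rm.
  rewrite exchange_big /=; apply: eq_bigr => b _; rewrite -mulr_suml.
  congr (_ * _); rewrite -rmorph_sum; congr (_%:C).
  rewrite sumrB -mulr_suml sumr_const_nat subn0.
  have S k : \sum_(0 <= i < k) (i * q + b)%:R =
      k%:R * b%:R + q%:R * (k%:R * (k%:R - 1) / 2) :> R.
    elim: k => [|k IH]; first by rewrite big_nil; ring.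
    by rewrite big_nat_recr //= IH natrD natrM -natr1; field.
  rewrite S -mulr_natl natrM; field.
  by rewrite p0R q0R.
- rewrite mulnC big_nat_mul.
  rewrite /beta mulr_sumr big_mkord; apply: eq_bigr => b _.
  rewrite big_ltn ?ltn_mul2r ?p0 ?ltnSn // dvdn_mull //.
  rewrite big_nat big1 => [|j /andP[lj jb]]; last first.
    case: ifP => // /dvdnP[k jk]; move: lj jb; rewrite jk.
    by rewrite !ltn_mul2r p0 /= ltnS => bk /(leq_trans bk); rewrite ltnn.
  rewrite Monoid.mulm1 rM mulrA mulrC; congr (_ * (_ * _)).
  rewrite /w !natrM; congr ((_ - _)%:C); field.
  by rewrite p0R q0R.
Qed.

End Lowering.
End DirichletCharacters.

(** * Completeness of the characters modulo n *)

Section Completeness.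
Variable R : realType.

Lemma adc_eq n a b : (0 < n)%N -> adc R n a = adc R n b -> a = b %[mod n].
Proof.
move=> n0; wlog ab : a b / (b <= a)%N => [IH|].
  by have [/IH//|/ltnW/IH IH' /esym/IH'] := leqP b a.
rewrite -{1}(subnK ab) adcD -{2}[adc R n b]mul1r => /mulIf e.
apply/eqP; rewrite eqn_mod_dvd // -(adc_eq1 R) //; apply/eqP; apply: e.
by apply: contra_eq_neq (adc_unit R n b) => ->; rewrite mul0r eq_sym oner_eq0.
Qed.

(** The irreducible characters of the unit group over the algebraic numbers
    take values among the powers of one root of unity z.  Reading off the
    exponents and using them with a root of unity of the same order in R[i]
    gives as many characters as there are units. *)
Lemma dchar_complete_family n : (1 < n)%N ->
  exists (I : finType) (chi : I -> nat -> R[i]),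
    dchar_family n xpredT chi /\ #|I| = totient n.
Proof.
move=> n1; have n0 := ltnW n1.
pose U : finGroupType := {unit 'Z_n}; pose G := [group of units_Zp n].
have GT (g : U) : g \in G by rewrite inE.
have abG : abelian G := units_Zp_abelian n.
have cardG : #|G| = totient n := card_units_Zp n0.
pose N := #|G|; have N0 : (0 < N)%N by exact: cardG_gt0.
have [z prim_z] := C_prim_root_exists N0.
pose I := Iirr G; exists I.
have lin (i : I) : 'chi_i \is a linear_char by exact: (char_abelianP _ abG).
have unity (i : I) (g : U) : 'chi_i g ^+ N = 1.
  rewrite -lin_charX // /N; have /dvdnP[k ->] := order_dvdG (GT g).
  by rewrite mulnC expgM expg_order expg1n lin_char1.
pose e (i : I) (g : U) : nat := sval (prim_rootP prim_z (unity i g)).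
have eE i g : 'chi_i g = z ^+ e i g.
  exact: svalP (prim_rootP prim_z (unity i g)).
pose un (a : nat) : U := insubd (1%g : U) (a%:R : 'Z_n).
have unE a : coprime a n -> val (un a) = a%:R :> 'Z_n.
  move=> an; rewrite /un val_insubd.
  by rewrite ifT // unitZpE // coprime_sym.
have unP a b : coprime a n -> coprime b n -> (a%:R = b%:R :> 'Z_n) -> un a = un b.
  by move=> an bn ab; apply: val_inj; rewrite !unE.
have eM i g h : e i (g * h)%g = (e i g + e i h)%N %[mod N].
  apply/eqP; rewrite -(eq_prim_root_expr prim_z) -eE lin_charM //.
  by rewrite exprD -!eE.
pose chi (i : I) a := if coprime a n then adc R N (e i (un a)) else 0.
exists chi; split; last by rewrite card_Iirr_abelian.
split => [i _|i j _ _ ij].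
  split => [|a b|a|a na].
  - rewrite /chi coprime1n.
    have : (e i (un 1) = 0 %[mod N])%N.
      apply/eqP; rewrite -(eq_prim_root_expr prim_z) -eE expr0.
      have -> : un 1 = 1%g by apply: val_inj; rewrite unE ?coprime1n.
      by rewrite lin_char1.
    by move=> e0; rewrite -adc_mod // e0 mod0n adc0.
  - rewrite /chi coprimeMl; case: (boolP (coprime a n)) => an /=; last by rewrite mul0r.
    case: (boolP (coprime b n)) => bn; last by rewrite mulr0.
    have -> : un (a * b) = (un a * un b)%g.
      by apply: val_inj; rewrite /= !unE ?coprimeMl ?an // natrM.
    by rewrite -adcD -adc_mod // eM adc_mod.
  - rewrite /chi coprime_modl; case: ifP => // an.
    by congr (adc R N (e i _)); apply: unP; rewrite ?coprime_modl // Zp_nat_mod.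
  - by rewrite /chi (negPf na).
have : exists g : U, 'chi_i g != 'chi_j g.
  apply/existsP; apply: contraR ij; rewrite negb_exists => /forallP H.
  apply/eqP/irr_inj/cfunP => g; apply/eqP; move: (H g); rewrite negbK.
  by [].
case=> g ne; exists (val g : 'Z_n).
have gn : coprime (val g : 'Z_n) n.
  by rewrite coprime_sym -unitZpE // natr_Zp (valP g).
have ung : un (val g : 'Z_n) = g by apply: val_inj; rewrite unE // natr_Zp.
rewrite /chi gn ung => /(adc_eq N0) /eqP.
by rewrite -(eq_prim_root_expr prim_z) -!eE (negPf ne).
Qed.

(** For the indicator function of m modulo n the defect in Bessel's inequality
    is phi(n) - #|I| up to a factor, hence 0, so that this function equals its
    expansion. *)
Lemma dchar_column_orth n (I : finType) (chi : I -> nat -> R[i]) m x :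
  (0 < n)%N -> dchar_family n xpredT chi -> #|I| = totient n -> coprime m n ->
  \sum_i (chi i m)^* * chi i x = if x == m %[mod n] then (totient n)%:R else 0.
Proof.
move=> n0 fam cI mn.
have [chiD dist] := fam.
pose g (a : 'I_n) : R[i] := (nat_of_ord a == m %% n)%N%:R.
have gS (F : nat -> R[i]) : \sum_(a < n) g a * F a = F (m %% n)%N.
  rewrite (bigD1 (Ordinal (ltn_pmod m n0))) //= /g eqxx mul1r big1 ?addr0 // => a.
  by rewrite -val_eqE /= => /negPf ->; rewrite mul0r.
have orth (i j : I) : true -> true ->
    \sum_(a < n) chi i a * (chi j a)^* = if i == j then (totient n)%:R%:C else 0.
  move=> _ _; case: eqP => [<-|/eqP ij].
    by rewrite (dchar_sum_sqr (chiD i isT) n0) rmorph_nat.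
  by have [a] := dist i j isT isT ij; exact: dchar_orth (chiD i isT) (chiD j isT) n0.
have := bessel_defect g orth.
have cg (i : I) : \sum_(a < n) g a * chi i a = chi i m.
  by rewrite (gS (chi i)); case: (chiD i isT).
have -> : \sum_(a < n) normc (g a) ^+ 2 = 1.
  rewrite (bigD1 (Ordinal (ltn_pmod m n0))) //= big1 /g ?eqxx ?normc_nat ?addr0 ?expr1n //.
  by move=> a; rewrite -val_eqE /= => /negPf ->; rewrite normc0 expr0n.
have -> : \sum_(i | xpredT i) normc (\sum_(a < n) g a * chi i a) ^+ 2 = (totient n)%:R.
  rewrite -cI -sum1_card natr_sum; apply: eq_bigr => i _.
  by rewrite cg (dchar_norm (chiD i isT)) // expr1n.
rewrite mulr1 subrr mulr0 => /eqP; rewrite psumr_eq0; last by move=> a _; rewrite sqr_ge0.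
move/allP => /(_ (Ordinal (ltn_pmod x n0))); rewrite mem_index_enum => /(_ isT) /=.
rewrite sqrf_eq0 => /eqP/eq0_normc/eqP; rewrite subr_eq0 => /eqP.
rewrite /g /= => /(congr1 Num.conj).
rewrite rmorphM !rmorph_nat rmorph_sum /= => E.
transitivity ((totient n)%:R * (x %% n == m %% n)%N%:R : R[i]); last first.
  by case: eqP; rewrite ?mulr1 ?mulr0.
rewrite E; apply: eq_bigr => i _.
by rewrite rmorphM /= conjCK cg; case: (chiD i isT) => _ _ -> _.
Qed.

End Completeness.

(** * Gauss sums and the sawtooth of a primitive character *)

Section GaussSums.
Variable R : realType.
Implicit Types (n j : nat) (chi : nat -> R[i]).

(** Induction from n/p for the primes p dividing n suffices to exclude all
    smaller moduli. *)
Definition primitive n chi :=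
  all (fun p => ~~ induced_from p (n %/ p) chi) (primes n).

Definition gauss n chi j : R[i] := \sum_(a < n) chi a * adc R n (j * a).

(** For a unit j substitute a -> j a.  If a prime p divides both j and n,
    primitivity provides u = 1 modulo n/p with chi u <> 1; as a -> u a
    preserves the phases exp (2 i pi j a / n), the sum vanishes. *)
Lemma gauss_sep n chi j : dchar n chi -> (0 < n)%N -> primitive n chi ->
  gauss n chi j = (chi j)^* * gauss n chi 1.
Proof.
move=> chiD n0 prim; have [_ cM cm c0] := chiD.
have [jn|nj] := boolP (coprime j n).
  have <- : chi j * gauss n chi j = gauss n chi 1.
    rewrite /gauss -[RHS](big_unit_mul (fun a => chi a * adc R n (1 * a)) n0 jn).
    rewrite mulr_sumr; apply: eq_bigr => a _.
    by rewrite mul1n adc_mod // cm cM mulrA.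
  by rewrite mulrA [_^* * _]mulrC (dchar_conj chiD) // mul1r.
rewrite (c0 j) // conjC0 mul0r.
have g1 : (1 < gcdn j n)%N by rewrite ltn_neqAle eq_sym nj gcdn_gt0 n0 orbT.
set p := pdiv (gcdn j n).
have p_pr : prime p := pdiv_prime g1.
have pj : (p %| j)%N := dvdn_trans (pdiv_dvd _) (dvdn_gcdl _ _).
have pn : (p %| n)%N := dvdn_trans (pdiv_dvd _) (dvdn_gcdr _ _).
move/allP/(_ p): prim; rewrite mem_primes p_pr n0 pn => /(_ isT).
rewrite negb_forall => /existsP[u]; rewrite negb_imply -andbA.
case/and3P; have e : (p * (n %/ p) = n)%N by rewrite mulnC divnK.
move: (nat_of_ord u) => {}u; rewrite e => un /eqP u1 cu1.
have : chi u * gauss n chi j = gauss n chi j.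
  rewrite /gauss -[RHS](big_unit_mul (fun a => chi a * adc R n (j * a)) n0 un).
  rewrite mulr_sumr; apply: eq_bigr => a _.
  rewrite cm cM mulrA; congr (_ * _).
  rewrite -[LHS]adc_mod // -[RHS]adc_mod //; congr adc.
  have ju : (j * u = j %[mod n])%N.
    rewrite -(divnK pj) -mulnA -modnMmr -{1}e -muln_modr u1 muln_modr muln1 e.
    by rewrite modnMmr.
  by rewrite modnMmr mulnA -(modnMml (j * u)) ju modnMml.
move/eqP; rewrite -subr_eq0 -{2}[gauss n chi j]mul1r -mulrBl mulf_eq0 subr_eq0.
by rewrite (negPf cu1) => /eqP.
Qed.

Lemma adc_bessel n (g : nat -> R[i]) : (0 < n)%N ->
  \sum_(j < n) normc (\sum_(x < n) g x * adc R n (j * x)) ^+ 2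
    <= n%:R * \sum_(x < n) normc (g x) ^+ 2.
Proof.
move=> n0; apply: (@bessel R 'I_n 'I_n xpredT n%:R
  (fun j a : 'I_n => adc R n (j * a)) (fun a : 'I_n => g a)); first by rewrite ltr0n.
move=> i j _ _; transitivity (\sum_(x < n) adc R n ((i + (n - j)) * x)).
  apply: eq_bigr => x _; rewrite mulnDl adcD; congr (_ * _).
  by rewrite !adcM adc_compl ?rmorphXn // ltnW.
rewrite adc_sum // rmorph_nat; congr (if _ then _ else _).
apply/idP/eqP => [|->]; last by rewrite subnKC ?dvdnn // ltnW.
by case/dvdnP => -[|[|k]] E; apply: val_inj => /=; move: (ltn_ord i) (ltn_ord j); nia.
Qed.

(** By separability all phi(n) Gauss sums at units have the same modulus, and
    Bessel's inequality for additive characters bounds their mean square. *)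
Lemma gauss_norm n chi : dchar n chi -> (0 < n)%N -> primitive n chi ->
  normc (gauss n chi 1) ^+ 2 <= n%:R.
Proof.
move=> chiD n0 prim; have := adc_bessel chi n0.
have -> : \sum_(x < n) normc (chi x) ^+ 2 = (totient n)%:R.
  apply: complexI; rewrite rmorph_sum rmorph_nat -(dchar_sum_sqr chiD n0) /=.
  by apply: eq_bigr => a _; rewrite sqr_normcE.
have -> : \sum_(j < n) normc (\sum_(x < n) chi x * adc R n (j * x)) ^+ 2 =
   (totient n)%:R * normc (gauss n chi 1) ^+ 2.
  rewrite -sum_coprime mulr_suml; apply: eq_bigr => j _.
  rewrite -/(gauss n chi j) gauss_sep // normcM normc_conj exprMn.
  have [jn|nj] := boolP (coprime j n); first by rewrite (dchar_norm chiD) // expr1n.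
  by case: chiD => _ _ _ ->; rewrite // normc0 expr0n.
by rewrite mulrC ler_pM2r // ltr0n totient_gt0.
Qed.

(** The j-th Fourier coefficient of the sawtooth on the residues modulo n. *)
Definition saw n j : R[i] :=
  n%:R^-1 * \sum_(b < n) (b%:R / n%:R - 2^-1 : R)%:C * (adc R n (j * b))^*.

Lemma beta_gauss n chi : dchar n chi -> (0 < n)%N -> primitive n chi ->
  beta n chi = gauss n chi 1 * \sum_(j < n) saw n j * (chi j)^*.
Proof.
move=> chiD n0 prim; rewrite mulr_sumr.
transitivity (\sum_(j < n) saw n j * gauss n chi j); last first.
  by apply: eq_bigr => j _; rewrite gauss_sep //; ring.
rewrite /gauss; under eq_bigr do rewrite mulr_sumr.
rewrite exchange_big; apply: eq_bigr => a _ /=.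
under eq_bigr do rewrite mulrCA; rewrite -mulr_sumr mulrC; congr (_ * _).
have nn : n%:R != 0 :> R[i] by rewrite pnatr_eq0 -lt0n.
rewrite -[LHS](mulKf nn) /saw; under eq_bigr do rewrite -mulrA mulr_suml.
rewrite -mulr_sumr exchange_big /=; congr (_ * _).
rewrite (bigD1 a) //= [\sum_(b < n | b != a) _]big1 ?addr0 => [|b ba].
  under eq_bigr do rewrite -mulrA [_^* * _]mulrC adc_unit mulr1.
  by rewrite sumr_const card_ord -[RHS]mulr_natl.
under eq_bigr do rewrite -mulrA; rewrite -mulr_sumr.
rewrite [X in _ * X](_ : _ = \sum_(j < n) adc R n ((a + (n - b)) * j)).
  rewrite adc_sum // ifN ?mulr0 //; apply: contra ba.
  case/dvdnP => -[|[|k]] E; apply/eqP; apply: val_inj => /=;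
  move: (ltn_ord a) (ltn_ord b); nia.
apply: eq_bigr => j _; rewrite mulnDl adcD [RHS]mulrC [(j * b)%N]mulnC [(j * a)%N]mulnC.
by congr (_ * _); rewrite !adcM adc_compl ?rmorphXn // ltnW.
Qed.

Lemma saw_conj n j : (0 < n)%N -> (j <= n)%N -> saw n (n - j) = (saw n j)^*.
Proof.
move=> n0 jn; rewrite /saw rmorphM rmorph_sum fmorphV rmorph_nat; congr (_ * _).
apply: eq_bigr => b _; rewrite rmorphM /= conjC_real; congr (_ * _).
congr (_^*).
by rewrite !adcM adc_compl // rmorphXn.
Qed.

Lemma sum_natX (x : R[i]) m :
  (x - 1) * \sum_(b < m) b%:R * x ^+ b = m%:R * x ^+ m - x * \sum_(b < m) x ^+ b.
Proof.
elim: m => [|m IH]; first by rewrite !big_ord0 !mulr0 mul0r subr0.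
by rewrite !big_ord_recr /= !mulrDr IH -natr1 exprS; ring.
Qed.

(** With x = exp (- 2 i pi j / n) the derivative of the geometric sum gives
    (x - 1) * saw n j = 1/n, and |x - 1| >= j/n. *)
Lemma saw_bound n j : (0 < j)%N -> (j.*2 <= n)%N ->
  normc (saw n j) <= j%:R^-1.
Proof.
move=> j0 j2; have n0 : (0 < n)%N by lia.
have n0R : n%:R != 0 :> R[i] by rewrite pnatr_eq0 -lt0n.
set x := (adc R n j)^*.
have xb b : (adc R n (j * b))^* = x ^+ b by rewrite adcM rmorphXn.
have xn : x ^+ n = 1 by rewrite -xb mulnC adcM adcnn // expr1n conjC1.
have sx : \sum_(b < n) x ^+ b = 0.
  under eq_bigr do rewrite -xb; rewrite -rmorph_sum adc_sum //.
  by rewrite ifN ?rmorph0 // gtnNdvd //; clear -j0 j2; lia.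
have E : (x - 1) * saw n j = n%:R^-1.
  rewrite /saw mulrCA -[RHS]mulr1; congr (_ * _).
  transitivity ((x - 1) * (n%:R^-1 * (\sum_(b < n) b%:R * x ^+ b)
    - 2^-1 * \sum_(b < n) x ^+ b)).
    congr (_ * _); rewrite !mulr_sumr -sumrB; apply: eq_bigr => b _.
    rewrite xb rmorphB rmorphM /= !fmorphV !rmorph_nat; ring.
  rewrite sx mulr0 subr0 mulrCA sum_natX sx mulr0 subr0 xn mulr1.
  by rewrite mulVf.
have D := @adc_dist R n j n0 j2.
have xd : normc (x - 1) = normc (adc R n j - 1).
  by rewrite -[RHS]normc_conj rmorphB rmorph1.
have := congr1 (@normc R) E; rewrite normcM normcV normc_nat xd => E'.
have j0R : 0 < j%:R :> R by rewrite ltr0n.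
have n0' : 0 < n%:R :> R by rewrite ltr0n.
rewrite -[leRHS]mul1r ler_pdivlMr // mulrC.
apply: le_trans (ler_wpM2r (normc_ge0 _) D) _.
by rewrite -mulrA E' divff ?gt_eqF.
Qed.

(** The coefficients at j and n - j are conjugate, so that the sum folds onto
    j <= n/2, at the price of two sums. *)
Lemma beta_primitive_le n chi : dchar n chi -> (1 < n)%N -> odd n ->
  primitive n chi ->
  normc (beta n chi) <= normc (gauss n chi 1) *
    (normc (\sum_(1 <= j < n./2.+1) (saw n j)^* * chi j) +
     normc (\sum_(1 <= j < n./2.+1) saw n j * chi j)).
Proof.
move=> chiD n1 oddn prim; have n0 : (0 < n)%N by lia.
rewrite beta_gauss // normcM ler_wpM2l ?normc_ge0 //.
have [_ cM cm c0] := chiD.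
rewrite -(big_mkord xpredT (fun j => saw n j * (chi j)^*)) big_ltn //.
rewrite (c0 0%N) ?conjC0 ?mulr0 ?add0r; last by rewrite /coprime gcd0n; lia.
rewrite (@big_cat_nat _ _ _ n./2.+1) //=; [|lia].
apply: le_trans (le_normcD _ _) _; apply: lerD.
  rewrite -normc_conj rmorph_sum le_eqVlt; apply/orP; left; apply/eqP.
  by congr normc; apply: eq_bigr => j _; rewrite rmorphM /= conjCK.
rewrite big_nat_rev /= (_ : n./2.+1 = 1 + n./2)%N // big_addn.
rewrite (_ : n - n./2 = n./2.+1)%N; last by lia.
have -> : \sum_(1 <= i < n./2.+1) saw n (1 + n./2 + n - (i + n./2).+1)
    * (chi (1 + n./2 + n - (i + n./2).+1)%N)^* =
   (chi (n - 1)%N)^* * (\sum_(1 <= j < n./2.+1) saw n j * chi j)^*.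
  rewrite rmorph_sum mulr_sumr big_nat [RHS]big_nat; apply: eq_bigr => j /andP[j1 jn].
  rewrite (_ : 1 + n./2 + n - _ = n - j)%N; last by lia.
  rewrite saw_conj //; last by lia.
  rewrite (@dchar_modP _ _ _ _ ((n - 1) * j)%N chiD).
    by rewrite cM !rmorphM /=; ring.
  apply/eqP; rewrite mulnBl mul1n.
  rewrite (_ : n * j - j = n * j.-1 + (n - j))%N; last by nia.
  by rewrite mulnC modnMDl.
rewrite normcM !normc_conj ler_piMl ?normc_ge0 //.
exact: dchar_norm_le1 chiD n0.
Qed.

End GaussSums.

(** * The pointwise bound *)

Section Descent.
Variable R : realType.
Implicit Types (n p q : nat) (chi : nat -> R[i]).

Definition nontrivial n chi := exists2 a, coprime a n & chi a != 1.

Lemma nontrivial_gt1 n chi : dchar n chi -> (0 < n)%N -> nontrivial n chi -> (1 < n)%N.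
Proof.
move=> chiD n0 [a an]; rewrite ltn_neqAle n0 andbT; apply: contraNneq => n1.
by rewrite (@dchar_modP _ _ _ _ 1%N chiD) -?n1 ?modn1 //; case: chiD => ->.
Qed.

Lemma nontrivial_lower p q chi : prime p -> nontrivial (p * q) chi ->
  nontrivial q (lower p q chi).
Proof.
move=> p_pr [a]; rewrite coprimeMr => /andP[ap aq] ca; exists a => //.
by rewrite /lower ifN // -prime_coprime // coprime_sym.
Qed.

Lemma primitive_or_induced n chi : (0 < n)%N ->
  primitive n chi \/
  exists p q, [/\ prime p, n = (p * q)%N, (0 < q)%N & induced_from p q chi].
Proof.
move=> n0; case: (boolP (primitive n chi)); first by left.
case/allPn => p; rewrite mem_primes => /and3P[p_pr _ pn]; rewrite negbK => ind.
right; exists p, (n %/ p)%N; split => //; first by rewrite mulnC divnK.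
by rewrite divn_gt0 ?prime_gt0 // dvdn_leq.
Qed.

Lemma beta_lower_le p q chi : prime p -> (0 < q)%N -> dchar (p * q) chi ->
  induced_from p q chi ->
  normc (beta (p * q) chi) <=
    (if (p %| q)%N then 1 else 2) * normc (beta q (lower p q chi)).
Proof.
move=> p_pr q0 chiD ind; rewrite beta_lower // normcM ler_wpM2r ?normc_ge0 //.
have lD := lower_dchar p_pr q0 chiD ind.
case: ifP => pq.
  have [_ _ _ ->] := lD; first by rewrite subr0 normc1.
  by rewrite prime_coprime // pq.
apply: le_trans (le_normcD _ _) _; rewrite normc1 normcN.
by have := dchar_norm_le1 p lD q0; lra.
Qed.

Definition harm m : R := \sum_(1 <= j < m.+1) j%:R^-1.

Lemma harm_ge0 m : 0 <= harm m.
Proof. by apply: sumr_ge0 => j _; rewrite invr_ge0. Qed.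

Lemma harm_le m1 m2 : (m1 <= m2)%N -> harm m1 <= harm m2.
Proof.
move=> le12; rewrite /harm (@big_cat_nat _ _ _ m1.+1 1 m2.+1) //= ?ltnS //.
by rewrite lerDl; apply: sumr_ge0 => j _; rewrite invr_ge0.
Qed.

Lemma odd_prime_gt2 p q : prime p -> odd (p * q) -> (2 < p)%N.
Proof.
move=> p_pr; rewrite oddM => /andP[op _]; have := prime_gt1 p_pr.
by case: p p_pr op => [|[|[|]]].
Qed.

(** For primitive characters, |tau| <= sqrt n and two harmonic sums.  In the
    descent a factor 2 is at most sqrt p for p >= 5; for p = 3 it is paid by
    the weight that depends on whether 3 divides n. *)
Lemma polya_vinogradov n chi : odd n -> dchar n chi -> nontrivial n chi ->
  normc (beta n chi) <=
    (if (3 %| n)%N then 2 else 1) * Num.sqrt n%:R * (2 * harm n).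
Proof.
have [m] := ubnP n; elim: m n chi => // m IH n chi le_nm oddn chiD nt.
have n0 : (0 < n)%N by lia.
have H0 := harm_ge0.
have s0 k : 0 <= Num.sqrt (k%:R : R) by exact: sqrtr_ge0.
have [prim|[p [q [p_pr nE q0 ind]]]] := primitive_or_induced chi n0.
  have n1 := nontrivial_gt1 chiD n0 nt.
  have := beta_primitive_le chiD n1 oddn prim; move/le_trans; apply.
  have gs : normc (gauss n chi 1) <= Num.sqrt n%:R.
    by rewrite -[leLHS]ger0_norm ?normc_ge0 // -sqrtr_sqr ler_wsqrtr // gauss_norm.
  have sb (w : nat -> R[i]) : (forall j, (0 < j <= n./2)%N -> normc (w j) <= j%:R^-1) ->
      normc (\sum_(1 <= j < n./2.+1) w j * chi j) <= harm n.
    move=> wb; apply: le_trans (normc_sum _ _ _) _.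
    apply: (@le_trans _ _ (harm n./2)); last by apply: harm_le; lia.
    rewrite /harm !big_nat; apply: ler_sum => j jn; rewrite normcM.
    have := wb j jn; have := dchar_norm_le1 j chiD n0.
    have := normc_ge0 (w j); have := normc_ge0 (chi j).
    have : 0 <= j%:R^-1 :> R by rewrite invr_ge0.
    nra.
  apply: (@le_trans _ _ (Num.sqrt n%:R * (2 * harm n))).
    apply: ler_pM; rewrite ?normc_ge0 ?addr_ge0 ?normc_ge0 //.
    have := sb (fun j => (saw R n j)^*); have := sb (saw R n) => /(_ _)/wrap[j jn|A].
      by rewrite saw_bound //; lia.
    move=> /(_ _)/wrap[j jn|B]; first by rewrite normc_conj saw_bound //; lia.
    lra.
  apply: ler_wpM2r; first by rewrite mulr_ge0.
  by have := s0 n; case: ifP; lra.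
subst n; have p3 := odd_prime_gt2 p_pr oddn.
have oddq : odd q by move: oddn; rewrite oddM => /andP[].
apply: le_trans (beta_lower_le p_pr q0 chiD ind) _.
have lt_qm : (q < m)%N by nia.
have := IH q _ lt_qm oddq (lower_dchar p_pr q0 chiD ind) (nontrivial_lower p_pr nt).
move=> {}IH.
apply: le_trans (ler_wpM2l _ IH) _; first by case: ifP; lra.
rewrite !mulrA; apply: ler_pM; rewrite ?harm_ge0 //; last by apply: harm_le; nia.
  by do !apply: mulr_ge0 => //; case: ifP.
rewrite ler_wpM2r // natrM sqrtrM // !mulrA ler_wpM2r //.
(* For p = 3 the factor 2 is left to the weight. *)
have sp : (if (p == 3)%N then 1 else 2) <= Num.sqrt (p%:R : R).
  rewrite -[leLHS]ger0_norm; last by case: ifP; lra.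
  rewrite -sqrtr_sqr ler_wsqrtr //; case: eqP => [->|p_n3]; first by rewrite expr1n ler1n.
  rewrite -natrX ler_nat; move: p_pr p3 p_n3; clear.
  by case: p => [|[|[|[|[|]]]]].
rewrite Euclid_dvdM //; have := sp; case: (altP (p =P 3)) => [p_3|p_n3] sp'.
  move: sp'; rewrite p_3 dvdnn /=; case: ifP => _ /=; lra.
rewrite (@dvdn_prime2 3 p) // (eq_sym 3%N) (negPf p_n3) /=; case: ifP => _; case: ifP => _ /=; lra.
Qed.

End Descent.

(** * Ramanujan sums *)

Section Ramanujan.
Variable R : realType.
Implicit Types (n h a b : nat).

Lemma adc_modP n a b : (0 < n)%N -> a = b %[mod n] -> adc R n a = adc R n b.
Proof. by move=> n0 ab; rewrite -adc_mod // ab adc_mod. Qed.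

Definition ramanujan n h : R[i] := \sum_(b < n | coprime b n) adc R n (h * b).

(** The quotient of h * u by n is smaller than h, and together with the residue
    r it determines u. *)
Lemma card_mul_mod n h r : (0 < n)%N -> (0 < h)%N ->
  (#|[pred u : 'I_n | (h * u %% n)%N == r]| <= h)%N.
Proof.
move=> n0 h0; have lt_h (u : 'I_n) : (h * u %/ n < h)%N.
  by rewrite ltn_divLR // ltn_mul2l h0 ltn_ord.
pose f (u : 'I_n) := Ordinal (lt_h u).
rewrite -[leqRHS]card_ord -(@card_in_image _ _ f); first exact: max_card.
move=> u v; rewrite !inE => /eqP ur /eqP vr /(congr1 val) /= uv.
have : (h * u = h * v)%N by rewrite (divn_eq (h * u) n) (divn_eq (h * v) n) uv ur vr.
by move/eqP; rewrite eqn_pmul2l // => /eqP/val_inj.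
Qed.

(** The sum does not change when h is multiplied by a unit; the mean over all
    multiples h u is controlled by Bessel's inequality, as each residue occurs
    at most h times. *)
Lemma ramanujan_norm n h : (0 < n)%N -> (0 < h)%N ->
  normc (ramanujan n h) ^+ 2 <= (n * h)%:R.
Proof.
move=> n0 h0; pose F r := normc (ramanujan n r) ^+ 2.
have inv u : coprime u n -> ramanujan n (h * u %% n) = ramanujan n h.
  move=> un; rewrite /ramanujan [RHS]big_mkcond.
  rewrite -(big_unit_mul (fun b => if coprime b n then adc R n (h * b) else 0) n0 un).
  rewrite big_mkcond; apply: eq_bigr => b _ /=.
  rewrite coprime_modl coprimeMl un /=; case: ifP => // _.
  by apply: adc_modP; rewrite // modnMml modnMmr mulnA.
have tot : \sum_(r < n) F r <= n%:R * (totient n)%:R.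
  have := adc_bessel (fun b => (coprime b n)%:R : R[i]) n0.
  have -> : \sum_(x < n) normc ((coprime x n)%:R : R[i]) ^+ 2 = (totient n)%:R.
    rewrite -sum_coprime; apply: eq_bigr => x _.
    by rewrite normc_nat; case: coprime; rewrite ?expr1n ?expr0n.
  move=> H; apply: le_trans H; rewrite le_eqVlt; apply/orP; left; apply/eqP.
  apply: eq_bigr => r _; congr (normc _ ^+ 2); rewrite /ramanujan big_mkcond.
  by apply: eq_bigr => b _; case: coprime; rewrite ?mul1r ?mul0r.
have F0 r : 0 <= F r by rewrite sqr_ge0.
suff : (totient n)%:R * F h <= h%:R * (n%:R * (totient n)%:R).
  rewrite mulrA [h%:R * _]mulrC [leRHS]mulrC ler_pM2l ?ltr0n ?totient_gt0 //.
  by rewrite natrM.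
apply: le_trans (ler_wpM2l _ tot) => //.
rewrite -sum_coprime mulr_suml.
apply: (@le_trans _ _ (\sum_(u < n) F (h * u %% n)%N)).
  apply: ler_sum => u _; case: (boolP (coprime u n)) => un; last by rewrite mul0r.
  by rewrite mul1r /F inv.
have -> : \sum_(u < n) F (h * u %% n)%N =
    \sum_(u < n) \sum_(r < n) (if (h * u %% n)%N == r then F r else 0).
  apply: eq_bigr => u _.
  rewrite -big_mkcond (big_pred1 (Ordinal (ltn_pmod (h * u) n0))) //.
rewrite exchange_big mulr_sumr; apply: ler_sum => r _ /=.
rewrite -big_mkcond /= sumr_const -[leLHS]mulr_natl ler_wpM2r // ler_nat.
exact: card_mul_mod.
Qed.

(** Opening the square produces Ramanujan sums at x t - x t'; they are phi(n) on
    the diagonal and at most sqrt (n X) off it. *)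
Lemma coprime_mean_square n X (T : finType) (c : T -> R[i]) (x : T -> nat) :
  (0 < n)%N -> (forall t, x t <= X)%N ->
  \sum_(a < n | coprime a n) normc (\sum_t c t * adc R n (x t * a)) ^+ 2 <=
  (totient n)%:R * (\sum_t \sum_(t' | x t' == x t) normc (c t) * normc (c t'))
  + Num.sqrt (n * X)%:R * (\sum_t normc (c t)) ^+ 2.
Proof.
move=> n0 xX; set L := \sum_(_ < _ | _) _.
pose K t t' := \sum_(a < n | coprime a n) adc R n (x t * a) * (adc R n (x t' * a))^*.
have KC t t' : K t' t = (K t t')^*.
  by rewrite rmorph_sum; apply: eq_bigr => a _; rewrite rmorphM /= conjCK mulrC.
have Kd t t' : x t = x t' -> normc (K t t') <= (totient n)%:R.
  move=> e; apply: le_trans (normc_sum _ _ _) _; rewrite -sum_coprime.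
  rewrite big_mkcond; apply: ler_sum => a _; case: coprime => //.
  by rewrite e adc_unit normc1.
have Ko t t' : x t <> x t' -> normc (K t t') <= Num.sqrt (n * X)%:R.
  wlog lt : t t' / (x t' < x t)%N.
    move=> IH ne; have [lt|] := ltnP (x t') (x t); first exact: IH.
    rewrite leq_eqVlt => /orP[/eqP //|lt]; rewrite KC normc_conj.
    by apply: IH => // /esym.
  move=> _; have -> : K t t' = ramanujan n (x t - x t').
    apply: eq_bigr => a _; rewrite -{1}(subnK (ltnW lt)) mulnDl adcD -mulrA.
    by rewrite adc_unit mulr1.
  rewrite -[leLHS]ger0_norm ?normc_ge0 // -sqrtr_sqr ler_wsqrtr //.
  apply: le_trans (ramanujan_norm _ _) _; rewrite ?subn_gt0 // ler_nat.
  by rewrite leq_mul // (leq_trans (leq_subr _ _)).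
have LE : L%:C = \sum_t \sum_t' c t * (c t')^* * K t t'.
  rewrite rmorph_sum.
  transitivity (\sum_(a < n | coprime a n) \sum_t \sum_t'
      c t * (c t')^* * (adc R n (x t * a) * (adc R n (x t' * a))^*)).
    apply: eq_bigr => a _; rewrite /= sqr_normcE rmorph_sum mulr_suml.
    apply: eq_bigr => t _; rewrite mulr_sumr; apply: eq_bigr => t' _.
    by rewrite rmorphM /=; ring.
  rewrite exchange_big; apply: eq_bigr => t _ /=.
  by rewrite exchange_big; apply: eq_bigr => t' _ /=; rewrite mulr_sumr.
have L0 : 0 <= L by apply: sumr_ge0 => a _; rewrite sqr_ge0.
rewrite -[L]ger0_norm // -normc_real LE.
apply: le_trans (normc_sum _ _ _) _.
rewrite expr2 mulr_suml !mulr_sumr -big_split /=; apply: ler_sum => t _.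
apply: le_trans (normc_sum _ _ _) _.
rewrite (big_mkcond (fun t' => x t' == x t)) !mulr_sumr -big_split /=; apply: ler_sum => t' _.
rewrite !normcM normc_conj.
have c0 := normc_ge0 (c t); have c0' := normc_ge0 (c t').
case: eqP => [e|ne].
  have := ler_wpM2l (mulr_ge0 c0 c0') (Kd _ _ (esym e)).
  have : 0 <= Num.sqrt (n * X)%:R * (normc (c t) * normc (c t')).
    by rewrite !mulr_ge0 ?sqrtr_ge0.
  lra.
have := ler_wpM2l (mulr_ge0 c0 c0') (Ko _ _ (nesym ne)).
lra.
Qed.

End Ramanujan.

(** * The diagonal jl = j'l' *)

Section Diagonal.
Variable R : realType.

Lemma sum_le_uniq (I : finType) (P : pred I) (F : I -> R) M :
  0 <= M -> (forall i j, P i -> P j -> i = j) -> (forall i, P i -> F i <= M) ->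
  \sum_(i | P i) F i <= M.
Proof.
move=> M0 uniq le_FM; case: (pickP P) => [i Pi|P0]; last by rewrite big_pred0.
by rewrite (big_pred1 i) ?le_FM // => j; apply/idP/eqP => [Pj|->//]; exact: uniq.
Qed.

(** Telescoping: 1/(m+1)^2 <= 1/m - 1/(m+1). *)
Lemma sum_inv_sqr_tail y c :
  \sum_(a < y | (c <= a)%N) (a.+1%:R^-1) ^+ 2 <= 2 * c.+1%:R^-1 :> R.
Proof.
have S k : \sum_(c <= a < c.+1 + k) (a.+1%:R^-1) ^+ 2
    <= 2 * c.+1%:R^-1 - (c.+1 + k)%:R^-1 :> R.
  elim: k => [|k IH].
    rewrite addn0 big_nat1.
    have : c.+1%:R^-1 <= 1 :> R by rewrite invf_le1 ?ltr0n // ler1n.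
    have : 0 <= c.+1%:R^-1 :> R by rewrite invr_ge0.
    set t := c.+1%:R^-1 => t0 t1; have := mulr_ge0 t0 (_ : 0 <= 1 - t).
    by rewrite subr_ge0 => /(_ t1); lra.
  rewrite addnS big_nat_recr /=; last by lia.
  set m := (c.+1 + k)%N in IH *.
  have m0 : 0 < m%:R :> R by rewrite ltr0n /m addSn.
  apply: le_trans (lerD IH (lexx _)) _.
  set x : R := m%:R in m0 *.
  rewrite -addrA lerD2l -subr_ge0 -[m.+1%:R]natr1 -/x.
  have -> : - (x + 1)^-1 - (- x^-1 + (x + 1)^-1 ^+ 2) = x^-1 * ((x + 1)^-1 ^+ 2).
    by field; apply/andP; split; apply: lt0r_neq0; lra.
  by rewrite mulr_ge0 ?sqr_ge0 // invr_ge0 ltW.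
rewrite -(big_geq_mkord c y xpredT (fun a => (a.+1%:R^-1) ^+ 2)).
have [yc|cy] := leqP y c; first by rewrite big_geq // mulr_ge0 ?invr_ge0.
rewrite -(subnKC cy); apply: le_trans (S _) _.
by rewrite gerBl invr_ge0.
Qed.

Let w y (a : 'I_y) : R := a.+1%:R^-1.

(** The third variable c being at most the first two, a and b, and the fourth
    determined by the others, the sum is at most the sum over c of the square
    of the sum of 1/a^2 over a >= c, that is at most 4 times the sum of 1/c^2. *)
Lemma diagonal_min y :
  \sum_(q : ('I_y * 'I_y) * ('I_y * 'I_y) |
     ((q.1.1.+1 * q.1.2.+1 == q.2.1.+1 * q.2.2.+1)%N)
     && ((q.2.1 <= q.1.1) && (q.2.1 <= q.1.2))%N)
    w q.1.1 * w q.1.2 * (w q.2.1 * w q.2.2) <= 8.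
Proof.
have w0 a : 0 <= @w y a by rewrite invr_ge0.
rewrite big_mkcond.
rewrite -(pair_bigA _ (fun s t : 'I_y * 'I_y =>
  if ((s.1.+1 * s.2.+1 == t.1.+1 * t.2.+1)%N)
     && ((t.1 <= s.1) && (t.1 <= s.2))%N
  then w s.1 * w s.2 * (w t.1 * w t.2) else 0)) /=.
apply: (@le_trans _ _ (\sum_(s : 'I_y * 'I_y) \sum_(c < y)
   if (c <= s.1)%N && (c <= s.2)%N then w s.1 ^+ 2 * w s.2 ^+ 2 else 0)).
  apply: ler_sum => s _.
  rewrite -(pair_bigA _ (fun c d : 'I_y =>
  if ((s.1.+1 * s.2.+1 == c.+1 * d.+1)%N)
     && ((c <= s.1) && (c <= s.2))%N
  then w s.1 * w s.2 * (w c * w d) else 0)) /=.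
  apply: ler_sum => c _; rewrite -big_mkcond /=.
  case: ifP => cs; last by rewrite big_pred0 // => d; rewrite andbF.
  apply: sum_le_uniq => [|d d'|d].
  - by rewrite mulr_ge0 ?sqr_ge0.
  - rewrite !andbT => /eqP -> /eqP; move/eqP; rewrite eqn_pmul2l // eqSS.
    by move=> /eqP/val_inj.
  - rewrite andbT => /eqP e; rewrite -exprMn expr2.
    rewrite -[w c * w d]invfM -natrM -e natrM invfM.
    by rewrite [w s.1 * _]mulrC.
rewrite exchange_big /=.
apply: (@le_trans _ _ (\sum_(c < y) 4 * (w c ^+ 2))).
  apply: ler_sum => c _; rewrite -big_mkcond /=.
  rewrite -(pair_big (fun a : 'I_y => (c <= a)%N) (fun b : 'I_y => (c <= b)%N)
    (fun a b => w a ^+ 2 * w b ^+ 2)) /=.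
  under eq_bigr do rewrite -mulr_sumr; rewrite -mulr_suml.
  have H := sum_inv_sqr_tail y c.
  have H0 : 0 <= \sum_(a < y | (c <= a)%N) w a ^+ 2.
    by apply: sumr_ge0 => a _; rewrite sqr_ge0.
  rewrite -/(w c) in H.
  have -> : 4 * w c ^+ 2 = (2 * w c) * (2 * w c) by ring.
  exact: ler_pM.
rewrite -mulr_sumr; have := sum_inv_sqr_tail y 0; rewrite /= invr1 mulr1 /w.
lra.
Qed.

(** Some variable is minimal, and the equation and the weights are invariant
    under permutations that bring it to the third place. *)
Lemma diagonal_sum y :
  \sum_(s : 'I_y * 'I_y) \sum_(t : 'I_y * 'I_y |
     (t.1.+1 * t.2.+1 == s.1.+1 * s.2.+1)%N)
    w s.1 * w s.2 * (w t.1 * w t.2) <= 32.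
Proof.
have w0 a : 0 <= @w y a by rewrite invr_ge0.
pose Q : finType := (('I_y * 'I_y) * ('I_y * 'I_y))%type.
pose E (q : Q) := (q.1.1.+1 * q.1.2.+1 == q.2.1.+1 * q.2.2.+1)%N.
pose W (q : Q) := w q.1.1 * w q.1.2 * (w q.2.1 * w q.2.2).
pose m (q : Q) := ((q.2.1 <= q.1.1) && (q.2.1 <= q.1.2))%N.
pose s1 (q : Q) : Q := (q.1, (q.2.2, q.2.1)).
pose s2 (q : Q) : Q := (q.2, q.1).
pose s3 (q : Q) : Q := (q.2, (q.1.2, q.1.1)).
have W0 q : 0 <= W q by rewrite !mulr_ge0.
have bnd (s : Q -> Q) : involutive s \/ injective s -> (forall q, E (s q) = E q) ->
    (forall q, W (s q) = W q) -> \sum_(q | E q && m (s q)) W q <= 8.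
  move=> sinj sE sW; have {}sinj : injective s by case: sinj => // /inv_inj.
  have := diagonal_min y; rewrite (reindex_inj sinj) /=.
  rewrite (eq_bigl (fun q => E q && m (s q))) => [|q]; last by rewrite -sE.
  by rewrite (eq_bigr W) // => q _; rewrite -sW.
have b0 := bnd id (or_intror (@inj_id _)) (fun _ => erefl) (fun _ => erefl).
have b1 : \sum_(q | E q && m (s1 q)) W q <= 8.
  apply: bnd => [|q|q]; first by left; case=> [[? ?] [? ?]].
    by rewrite /E /s1 /= [X in _ == X]mulnC.
  by rewrite /W /s1 /= [w q.2.2 * _]mulrC.
have b2 : \sum_(q | E q && m (s2 q)) W q <= 8.
  apply: bnd => [|q|q]; first by left; case=> [[? ?] [? ?]].
    by rewrite /E /s2 /= eq_sym.
  by rewrite /W /s2 /= mulrC.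
have b3 : \sum_(q | E q && m (s3 q)) W q <= 8.
  apply: bnd => [|q|q].
  - by right; case=> [[? ?] [? ?]] [[? ?] [? ?]] [-> -> -> ->].
  - by rewrite /E /s3 /= eq_sym [X in X == _]mulnC.
  - by rewrite /W /s3 /= mulrC [w q.1.2 * _]mulrC.
rewrite (pair_big_dep xpredT (fun s t : 'I_y * 'I_y =>
  (t.1.+1 * t.2.+1 == s.1.+1 * s.2.+1)%N)
  (fun s t => w s.1 * w s.2 * (w t.1 * w t.2))) /=.
rewrite -/(W _) (eq_bigl E) => [|q]; last by rewrite eq_sym.
apply: (@le_trans _ _ (\sum_(q | E q && m q) W q + \sum_(q | E q && m (s1 q)) W q
  + \sum_(q | E q && m (s2 q)) W q + \sum_(q | E q && m (s3 q)) W q)); last lra.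
rewrite !big_mkcondr -!big_split /=; apply: ler_sum => q _.
have := W0 q; rewrite /m /s1 /s2 /s3 /=.
have : [|| (q.2.1 <= q.1.1)%N && (q.2.1 <= q.1.2)%N, (q.2.2 <= q.1.1)%N && (q.2.2 <= q.1.2)%N,
   (q.1.1 <= q.2.1)%N && (q.1.1 <= q.2.2)%N | (q.1.2 <= q.2.1)%N && (q.1.2 <= q.2.2)%N].
  lia.
have four (e1 e2 e3 e4 : bool) (x : R) : [|| e1, e2, e3 | e4] -> 0 <= x ->
    x <= (if e1 then x else 0) + (if e2 then x else 0) + (if e3 then x else 0)
      + (if e4 then x else 0).
  by case: e1; case: e2; case: e3; case: e4 => //= _ x0; lra.
exact: four.
Qed.

End Diagonal.

(** * Fourth moment over primitive characters *)

Section FourthMoment.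
Variable R : realType.

(** The square of the inner sum has coefficients W x on the residues x.  For a
    unit x and a given j at most one l < n satisfies j l = x, and l > y, whence
    W x is at most harm h / (y + 1); the sum of all W x is at most (harm h)^2. *)
Lemma tail_moment n (I : finType) (P : pred I) (chi : I -> nat -> R[i])
    (u : nat -> R[i]) y h :
  dchar_family n P chi -> (0 < n)%N -> (h < n)%N ->
  (forall j, (0 < j <= h)%N -> normc (u j) <= j%:R^-1) ->
  \sum_(i | P i) normc (\sum_(y.+1 <= j < h.+1) u j * chi i j) ^+ 4
   <= (totient n)%:R * (harm R h ^+ 3 * y.+1%:R^-1).
Proof.
move=> fam n0 hn ub.
(* W x collects the products u j * u l with j l = x modulo n; V x majorizes it. *)
pose J := 'I_h.+1; pose B (j : J) := (y < j)%N.
pose c (j l : J) x : bool := (j * l %% n == x)%N.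
pose W x : R[i] := \sum_(j | B j) \sum_(l | B l) (if c j l x then u j * u l else 0).
pose w (j : J) : R := j%:R^-1.
pose V x : R := \sum_(j | B j) \sum_(l | B l) (if c j l x then w j * w l else 0).
have w0 j : 0 <= w j by rewrite invr_ge0.
have V0 x : 0 <= V x.
  apply: sumr_ge0 => j _; apply: sumr_ge0 => l _; case: ifP => // _.
  exact: mulr_ge0.
have sw : \sum_(j | B j) w j <= harm R h.
  rewrite /harm (big_geq_mkord 1 h.+1 xpredT (fun j => j%:R^-1)) /=.
  rewrite big_mkcond [leRHS]big_mkcond; apply: ler_sum => j _.
  rewrite /B; case: ltnP => yj; first by rewrite (leq_ltn_trans _ yj).
  by case: ifP => // _; rewrite invr_ge0.
have sw0 : 0 <= \sum_(j | B j) w j by apply: sumr_ge0.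
have WV x : normc (W x) <= V x.
  apply: le_trans (normc_sum _ _ _) _; apply: ler_sum => j Bj.
  apply: le_trans (normc_sum _ _ _) _; apply: ler_sum => l Bl.
  case: ifP => _; rewrite ?normc0 // normcM ler_pM ?normc_ge0 ?ub //.
    by rewrite (leq_ltn_trans _ Bj) //= -ltnS ltn_ord.
  by rewrite (leq_ltn_trans _ Bl) //= -ltnS ltn_ord.
have Vmax x : coprime x n -> V x <= harm R h * y.+1%:R^-1.
  move=> xn; apply: (@le_trans _ _ (\sum_(j | B j) w j * y.+1%:R^-1)); last first.
    by rewrite -mulr_suml ler_wpM2r ?invr_ge0.
  apply: ler_sum => j Bj; rewrite -big_mkcondr /=.
  apply: sum_le_uniq => [|l l'|l].
  - by rewrite mulr_ge0 ?invr_ge0.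
  - move=> /andP[_ /eqP e] /andP[_ /eqP e']; apply: val_inj => /=.
    have jn : coprime j n.
      by move: xn; rewrite -e coprime_modl coprimeMl => /andP[].
    have : (j * l == j * l' %[mod n])%N by rewrite e e'.
    have lt_n (k : J) : (k < n)%N by rewrite (leq_ltn_trans _ hn) // -ltnS.
    by rewrite eqn_mod_unitl // !modn_small ?lt_n // => /eqP.
  - move=> /andP[Bl _]; rewrite ler_wpM2l // /w lef_pV2 ?posrE ?ltr0n ?ler_nat //.
    exact: leq_ltn_trans Bl.
have Vsum : \sum_(x < n) V x = (\sum_(j | B j) w j) ^+ 2.
  rewrite exchange_big expr2 mulr_suml; apply: eq_bigr => j _ /=.
  rewrite exchange_big mulr_sumr; apply: eq_bigr => l _ /=.
  rewrite -big_mkcond (big_pred1 (Ordinal (ltn_pmod (j * l) n0))) //=.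
  by move=> x; rewrite /= /c eq_sym -val_eqE.
have key : \sum_(i | P i) normc (\sum_(y.+1 <= j < h.+1) u j * chi i j) ^+ 4 =
    \sum_(i | P i) normc (\sum_(x < n) W x * chi i x) ^+ 2.
  apply: eq_bigr => i Pi; rewrite -[4%N]/(2 * 2)%N exprM -normcX.
  congr (normc _ ^+ 2).
  rewrite (big_geq_mkord y.+1 h.+1 xpredT (fun j => u j * chi i j)) /= -/J.
  have [_ cM cm _] := fam.1 i Pi.
  under [RHS]eq_bigr do rewrite mulr_suml.
  rewrite exchange_big expr2 mulr_suml; apply: eq_bigr => j _ /=.
  under [RHS]eq_bigr do rewrite mulr_suml.
  rewrite exchange_big mulr_sumr; apply: eq_bigr => l _ /=.
  rewrite (bigD1 (Ordinal (ltn_pmod (j * l) n0))) //= /c eqxx cm cM.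
  rewrite big1 ?addr0 => [|x]; first by ring.
  by rewrite -val_eqE /= eq_sym => /negPf ->; rewrite mul0r.
rewrite key; apply: le_trans (dchar_bessel W n0 fam) _.
rewrite ler_wpM2l //.
apply: (@le_trans _ _ (\sum_(x < n) V x * (harm R h * y.+1%:R^-1))).
  rewrite big_mkcond; apply: ler_sum => x _.
  have hy : 0 <= harm R h * y.+1%:R^-1 by rewrite mulr_ge0 ?harm_ge0 ?invr_ge0.
  case: ifP => xn; last by rewrite mulr_ge0.
  rewrite expr2; apply: ler_pM; rewrite ?normc_ge0 ?WV //.
  exact: le_trans (WV x) (Vmax x xn).
rewrite -mulr_suml Vsum [harm R h ^+ 3]exprSr -mulrA ler_wpM2r //.
  by rewrite mulr_ge0 ?harm_ge0 ?invr_ge0.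
by rewrite lerXn2r ?nnegrE ?harm_ge0.
Qed.

(** Two of the four Gauss sums are estimated by sqrt n; the other two turn the
    character values conj (chi (j l)) into phases by separability, before the
    characters are summed. *)
Lemma short_moment n (I : finType) (P : pred I) (chi : I -> nat -> R[i])
    (u : nat -> R[i]) y :
  dchar_family n P chi -> (0 < n)%N -> (forall i, P i -> primitive n (chi i)) ->
  (forall j, (0 < j <= y)%N -> normc (u j) <= j%:R^-1) ->
  \sum_(i | P i) normc (gauss n (chi i) 1) ^+ 4
     * normc (\sum_(1 <= j < y.+1) u j * chi i j) ^+ 4
   <= n%:R * ((totient n)%:R * ((totient n)%:R * 32
        + Num.sqrt n%:R * y%:R ^+ 5)).
Proof.
move=> fam n0 prim ub.
pose T : finType := ('I_y * 'I_y)%type.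
pose c (t : T) := (u t.1.+1 * u t.2.+1)^*.
pose x (t : T) := (t.1.+1 * t.2.+1)%N.
pose G a := \sum_t c t * adc R n (x t * a).
have GE i : P i -> normc (gauss n (chi i) 1) ^+ 2
     * normc (\sum_(1 <= j < y.+1) u j * chi i j) ^+ 4 =
   normc (\sum_(a < n) G a * chi i a) ^+ 2.
  move=> Pi; rewrite -[4%N]/(2 * 2)%N exprM -exprMn -normcX -[X in _ * X]normc_conj -normcM.
  congr (normc _ ^+ 2).
  have [_ cM _ _] := fam.1 i Pi.
  have -> : (\sum_(1 <= j < y.+1) u j * chi i j) ^+ 2 =
      \sum_(t : T) u t.1.+1 * chi i t.1.+1 * (u t.2.+1 * chi i t.2.+1).
    rewrite big_add1 /= big_mkord expr2 mulr_suml.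
    under [LHS]eq_bigr do rewrite mulr_sumr.
    by rewrite (pair_bigA _ (fun j l : 'I_y =>
      u j.+1 * chi i j.+1 * (u l.+1 * chi i l.+1))).
  rewrite rmorph_sum mulr_sumr.
  under [RHS]eq_bigr do rewrite mulr_suml.
  rewrite exchange_big; apply: eq_bigr => t _ /=.
  transitivity (c t * gauss n (chi i) (x t)).
    rewrite (gauss_sep (x t) (fam.1 i Pi) n0 (prim i Pi)).
    by rewrite /c /x cM !rmorphM /=; ring.
  by rewrite mulr_sumr; apply: eq_bigr => a _; rewrite mulnC; ring.
apply: (@le_trans _ _ (n%:R * \sum_(i | P i) normc (\sum_(a < n) G a * chi i a) ^+ 2)).
  rewrite mulr_sumr; apply: ler_sum => i Pi; rewrite -GE // mulrA.
  rewrite ler_wpM2r ?exprn_ge0 ?normc_ge0 // -[4%N]/(2 + 2)%N exprD.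
  rewrite ler_wpM2r ?sqr_ge0 // gauss_norm //; [exact: fam.1 | exact: prim].
rewrite ler_wpM2l //; apply: le_trans (dchar_bessel G n0 fam) _.
rewrite ler_wpM2l //.
have xX t : (x t <= y * y)%N by rewrite leq_mul.
apply: le_trans (coprime_mean_square c n0 xX) _.
have cb (t : T) : normc (c t) <= t.1.+1%:R^-1 * t.2.+1%:R^-1.
  by rewrite normc_conj normcM; apply: ler_pM; rewrite ?normc_ge0 //; apply: ub => /=.
apply: lerD.
  rewrite ler_wpM2l //; apply: le_trans (diagonal_sum R y).
  apply: ler_sum => s _; rewrite /= big_mkcond [leRHS]big_mkcond /=.
  apply: ler_sum => t _; case: ifP => // _.
  by rewrite ler_pM ?normc_ge0 ?cb.
have cs : \sum_t normc (c t) <= y%:R ^+ 2.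
  apply: (@le_trans _ _ (\sum_(t : T) 1)).
    apply: ler_sum => t _; apply: le_trans (cb t) _.
    have i1 k : k.+1%:R^-1 <= 1 :> R by rewrite invf_le1 ?ltr0n // ler1n.
    by rewrite -[leRHS]mulr1 ler_pM ?invr_ge0.
  by rewrite sumr_const card_prod card_ord natrM expr2.
have -> : Num.sqrt n%:R * y%:R ^+ 5 = Num.sqrt (n * (y * y))%:R * (y%:R ^+ 2) ^+ 2 :> R.
  rewrite !natrM sqrtrM // -expr2 sqrtr_sqr ger0_norm // -mulrA; congr (_ * _).
  by rewrite -exprM -exprS.
rewrite ler_wpM2l ?sqrtr_ge0 // lerXn2r ?nnegrE ?sqr_ge0 //.
by apply: sumr_ge0 => t _; rewrite normc_ge0.
Qed.

Lemma ler_pow4D (a b : R) : 0 <= a -> 0 <= b ->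
  (a + b) ^+ 4 <= 8 * (a ^+ 4 + b ^+ 4).
Proof.
move=> a0 b0.
have -> : 8 * (a ^+ 4 + b ^+ 4) = (a + b) ^+ 4
   + (a - b) ^+ 2 * (7 * a ^+ 2 + 10 * (a * b) + 7 * b ^+ 2) by ring.
rewrite lerDl mulr_ge0 ?sqr_ge0 // !addr_ge0 // !mulr_ge0 ?sqr_ge0 //.
Qed.

(** Two conjugate halves and the cut at y: the inequality
    (a + b)^4 <= 8 (a^4 + b^4) is used twice. *)
Lemma primitive_moment n (I : finType) (P : pred I) (chi : I -> nat -> R[i]) y :
  dchar_family n P chi -> (1 < n)%N -> odd n -> (y <= n./2)%N ->
  (forall i, P i -> primitive n (chi i)) ->
  \sum_(i | P i) normc (beta n (chi i)) ^+ 4 <=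
   128 * (n%:R * ((totient n)%:R * ((totient n)%:R * 32
        + Num.sqrt n%:R * y%:R ^+ 5))
     + n%:R ^+ 2 * ((totient n)%:R * (harm R n ^+ 3 * y.+1%:R^-1))).
Proof.
move=> fam n1 oddn yn prim; have n0 : (0 < n)%N by lia.
set h := n./2 in yn; have hn : (h < n)%N by rewrite /h; lia.
pose g i := normc (gauss n (chi i) 1).
have one (u : nat -> R[i]) :
    (forall j, (0 < j <= h)%N -> normc (u j) <= j%:R^-1) ->
  \sum_(i | P i) g i ^+ 4 * normc (\sum_(1 <= j < h.+1) u j * chi i j) ^+ 4 <=
   8 * (n%:R * ((totient n)%:R * ((totient n)%:R * 32
        + Num.sqrt n%:R * y%:R ^+ 5))
     + n%:R ^+ 2 * ((totient n)%:R * (harm R n ^+ 3 * y.+1%:R^-1))).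
  move=> ub.
  have uby j : (0 < j <= y)%N -> normc (u j) <= j%:R^-1.
    by move=> /andP[j0 jy]; rewrite ub // j0 (leq_trans jy).
  have S := @short_moment n I P chi u y fam n0 prim uby.
  have T := @tail_moment n I P chi u y h fam n0 hn ub.
  have T2 : n%:R ^+ 2 * \sum_(i | P i)
      normc (\sum_(y.+1 <= j < h.+1) u j * chi i j) ^+ 4 <=
      n%:R ^+ 2 * ((totient n)%:R * (harm R n ^+ 3 * y.+1%:R^-1)).
    rewrite ler_wpM2l ?sqr_ge0 //; apply: le_trans T _.
    rewrite ler_wpM2l // ler_wpM2r ?invr_ge0 // lerXn2r ?nnegrE ?harm_ge0 //.
    by apply: harm_le; exact: ltnW.
  apply: le_trans (ler_wpM2l _ (lerD S T2)) => //.
  rewrite mulr_sumr -big_split mulr_sumr; apply: ler_sum => i Pi /=.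
  rewrite (@big_cat_nat _ _ _ y.+1) //=.
  set s := \sum_(1 <= j < y.+1) _; set t := \sum_(y.+1 <= j < h.+1) _.
  have g0 : 0 <= g i by exact: normc_ge0.
  have g4 : g i ^+ 4 <= n%:R ^+ 2.
    rewrite -[4%N]/(2 * 2)%N exprM lerXn2r ?nnegrE ?sqr_ge0 //.
    apply: gauss_norm => //; [exact: fam.1 | exact: prim].
  have s0 := normc_ge0 s; have t0 := normc_ge0 t.
  apply: (@le_trans _ _ (g i ^+ 4 * (8 * (normc s ^+ 4 + normc t ^+ 4)))).
    rewrite ler_wpM2l ?exprn_ge0 //; apply: le_trans (ler_pow4D s0 t0).
    by rewrite lerXn2r ?nnegrE ?normc_ge0 ?addr_ge0 ?le_normcD.
  have := ler_wpM2r (exprn_ge0 4 t0) g4.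
  rewrite mulrCA mulrDr -/(g i); lra.
apply: (@le_trans _ _ (8 * (\sum_(i | P i) g i ^+ 4 *
      normc (\sum_(1 <= j < h.+1) (saw R n j)^* * chi i j) ^+ 4 +
   \sum_(i | P i) g i ^+ 4 *
      normc (\sum_(1 <= j < h.+1) saw R n j * chi i j) ^+ 4))).
  rewrite -big_split mulr_sumr; apply: ler_sum => i Pi /=.
  have g0 : 0 <= g i by exact: normc_ge0.
  set a := normc (\sum_(_ <= j < _) (saw R n j)^* * _).
  set b := normc (\sum_(_ <= j < _) saw R n j * _).
  have a0 : 0 <= a := normc_ge0 _; have b0 : 0 <= b := normc_ge0 _.
  apply: (@le_trans _ _ ((g i * (a + b)) ^+ 4)).
    rewrite lerXn2r ?nnegrE ?mulr_ge0 ?addr_ge0 ?normc_ge0 //.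
    exact: beta_primitive_le (fam.1 i Pi) n1 oddn (prim i Pi).
  rewrite exprMn; have := ler_wpM2l (exprn_ge0 4 g0) (ler_pow4D a0 b0).
  lra.
have := one (fun j => (saw R n j)^*) => /(_ _)/wrap[j jn|A].
  by rewrite normc_conj saw_bound; lia.
have := one (saw R n) => /(_ _)/wrap[j jn|B].
  by rewrite saw_bound; lia.
apply: le_trans (ler_wpM2l _ (lerD A B)) _ => //; set X := (X in 8 * X).
by have -> : 128 * X = 8 * (8 * X + 8 * X) by ring.
Qed.

End FourthMoment.

(** * Chebyshev and Mertens bounds, and a lower bound for the totient *)

Section Chebyshev.
Local Open Scope nat_scope.

Lemma prime_dvd_fact p n : prime p -> p %| n`! -> p <= n.
Proof.
move=> p_pr; elim: n => [|n IH]; first by rewrite fact0 dvdn1 => /eqP p1; rewrite p1 in p_pr.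
by rewrite factS Euclid_dvdM // => /orP[/dvdn_leq ->|/IH/leqW].
Qed.

Lemma prod_primes_dvd m k N :
  (forall p, prime p -> m <= p < k -> p %| N) ->
  \prod_(m <= p < k | prime p) p %| N.
Proof.
elim: k => [|k IH] H; first by rewrite big_geq ?dvd1n.
have [km|mk] := ltnP k m; first by rewrite big_geq ?dvd1n.
rewrite big_mkcond big_nat_recr //= -big_mkcond /=.
have H1 : \prod_(m <= p < k | prime p) p %| N.
  by apply: IH => p p_pr /andP[mp pk]; rewrite H // mp ltnW.
case: ifP => [k_pr|_]; last by rewrite muln1.
rewrite Gauss_dvd ?H1 ?H ?mk ?ltnSn //.
rewrite coprime_sym big_nat_cond.
elim/big_rec: _ => [|p x /andP[/andP[_ pk] p_pr] kx]; first exact: coprimen1.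
rewrite coprimeMr kx andbT prime_coprime //.
by rewrite gtnNdvd // prime_gt0.
Qed.

Lemma bin_mid m : 'C(m.*2.+1, m) <= 4 ^ m.
Proof.
have : 'C(m.*2.+1, m) + 'C(m.*2.+1, m.+1) <= 2 ^ m.*2.+1.
  have := expnDn 1 1 m.*2.+1; rewrite addn1 => ->.
  have lt1 : m < m.*2.+2 by lia.
  have lt2 : m.+1 < m.*2.+2 by lia.
  rewrite (bigD1 (Ordinal lt1)) //= (bigD1 (Ordinal lt2)) /=; last first.
    by rewrite -val_eqE /=; lia.
  by rewrite !exp1n !muln1 addnA leq_addr.
rewrite -(@bin_sub m.*2.+1 m.+1); last lia.
rewrite (_ : m.*2.+1 - m.+1 = m)%N; last lia.
by rewrite addnn expnS -muln2 mulnC leq_mul2l /= -muln2 mulnC expnM.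
Qed.

(** The primes in (k + 1, 2k + 1] divide the binomial coefficient of 2k + 1 over
    k, which is at most 4^k. *)
Lemma primorial_le n : \prod_(0 <= p < n.+1 | prime p) p <= 4 ^ n.
Proof.
have [m] := ubnP n; elim: m n => // m IH n le_nm.
have [|n2] := leqP n 2; first by case: n le_nm => [|[|[|]]] //; rewrite unlock.
have [oddn|evenn] := boolP (odd n); last first.
  rewrite big_mkcond big_nat_recr //= -big_mkcond /=.
  rewrite ifN ?muln1; last first.
    apply: contra evenn => /even_prime [n_2|//]; lia.
  rewrite -(ltn_predK n2); apply: leq_trans (IH n.-1 _) _; first lia.
  by rewrite leq_exp2l // leqnSn.
have -> : n = n./2.*2.+1 by have := odd_double_half n; lia.
set k := n./2; have k0 : 0 < k by rewrite /k; lia.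
rewrite (@big_cat_nat _ _ _ k.+2) //=; last lia.
apply: (@leq_trans (4 ^ k.+1 * 4 ^ k)); last by rewrite -expnD leq_exp2l //; lia.
apply: (@leq_mul (\prod_(0 <= p < k.+2 | prime p) p)
  (\prod_(k.+2 <= p < k.*2.+2 | prime p) p)); first by apply: IH; rewrite /k; lia.
apply: leq_trans (bin_mid k); apply: dvdn_leq; first by rewrite bin_gt0; lia.
apply: prod_primes_dvd => p p_pr /andP[kp pk].
have := dvdn_fact (n := k.*2.+1) (m := p); rewrite prime_gt0 //= => /(_ pk).
rewrite -(@bin_fact _ k); last lia.
rewrite !Euclid_dvdM // => /or3P[//|/prime_dvd_fact|/prime_dvd_fact]; lia.
Qed.

(** The exponent of p in N! is at least N / p. *)
Lemma prod_pow_le_fact N :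
  \prod_(0 <= p < N.+1 | prime p) p ^ (N %/ p) <= N`!.
Proof.
rewrite -[leqRHS](@partnT N`!) ?fact_gt0 //.
rewrite (@widen_partn N`!) //.
rewrite [leqRHS](_ : _ = \prod_(0 <= p < N`!.+1) p ^ logn p N`!); last first.
  by apply: eq_bigl => p; rewrite inE.
have NF : N.+1 <= N`!.+1.
  by rewrite ltnS; case: N => // N; rewrite factS leq_pmulr ?fact_gt0.
rewrite [leqRHS](@big_cat_nat _ _ _ N.+1) //=.
rewrite -[leqLHS]muln1 -[leqRHS]/(muln _ _); apply: leq_mul; last first.
  by apply: prodn_cond_gt0 => p _; exact: pfactor_gt0.
rewrite big_mkcond /=; apply: leq_prod => p _; case: ifP => p_pr; last exact: pfactor_gt0.
rewrite leq_exp2l ?prime_gt1 // logn_fact //.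
case: N {NF} => [|N]; first by rewrite div0n.
by rewrite big_ltn // expn1 leq_addr.
Qed.

End Chebyshev.

Local Open Scope ring_scope.

Section Mertens.
Variable R : realType.
Implicit Types (n N p t : nat).

Lemma ln_prod (I : Type) (r : seq I) (P : pred I) (F : I -> R) :
  (forall i, P i -> 0 < F i) ->
  ln (\prod_(i <- r | P i) F i) = \sum_(i <- r | P i) ln (F i).
Proof.
move=> F0.
suff [] : 0 < \prod_(i <- r | P i) F i /\
  ln (\prod_(i <- r | P i) F i) = \sum_(i <- r | P i) ln (F i) by [].
elim/big_rec2: _ => [|i x y Pi [y0 <-]]; first by rewrite ln1.
by rewrite mulr_gt0 ?F0 // lnM ?posrE ?F0.
Qed.

Definition prime_log_sum t : R := \sum_(0 <= p < t.+1 | prime p) ln p%:R / p%:R.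
Definition prime_inv_sum t : R := \sum_(0 <= p < t.+1 | prime p) p%:R^-1.

(** Compare N^N >= N! with the product of p^(N / p); rounding N / p down costs at
    most the logarithm of the primorial. *)
Lemma mertens1 N : (0 < N)%N -> prime_log_sum N <= ln N%:R + ln 4.
Proof.
move=> N0; have N0R : 0 < N%:R :> R by rewrite ltr0n.
have H1 : \sum_(0 <= p < N.+1 | prime p) ln (p%:R : R) <= N%:R * ln 4.
  rewrite -ln_prod => [|p p_pr]; last by rewrite ltr0n prime_gt0.
  rewrite mulr_natl -lnXn // ler_ln ?posrE ?exprn_gt0 //.
    by rewrite -natr_prod -natrX ler_nat primorial_le.
  by apply: prodr_gt0 => p p_pr; rewrite ltr0n prime_gt0.
have H2 : \sum_(0 <= p < N.+1 | prime p) (N %/ p)%:R * ln (p%:R : R)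
    <= N%:R * ln N%:R.
  apply: (@le_trans _ _ (ln (\prod_(0 <= p < N.+1 | prime p) (p%:R : R) ^+ (N %/ p)))).
    rewrite ln_prod => [|p p_pr]; last by rewrite exprn_gt0 // ltr0n prime_gt0.
    apply: ler_sum => p p_pr; rewrite lnXn ?ltr0n ?prime_gt0 //.
    by rewrite mulr_natl.
  rewrite [leRHS]mulr_natl -lnXn // ler_ln ?posrE ?exprn_gt0 //; last first.
    by apply: prodr_gt0 => p p_pr; rewrite exprn_gt0 // ltr0n prime_gt0.
  under eq_bigr do rewrite -natrX.
  rewrite -natr_prod -natrX ler_nat; apply: leq_trans (prod_pow_le_fact N) _.
  rewrite fact_prod big_add1 /= big_mkord.
  apply: (@leq_trans (\prod_(i < N) N)%N); first by apply: leq_prod => i _.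
  by rewrite prod_nat_const card_ord.
have H3 : N%:R * prime_log_sum N - \sum_(0 <= p < N.+1 | prime p) ln (p%:R : R) <=
   \sum_(0 <= p < N.+1 | prime p) (N %/ p)%:R * ln (p%:R : R).
  rewrite /prime_log_sum mulr_sumr -sumrB; apply: ler_sum => p p_pr.
  have p0 : 0 < p%:R :> R by rewrite ltr0n prime_gt0.
  have l0 : 0 <= ln (p%:R : R) by rewrite ln_ge0 // ler1n prime_gt0.
  rewrite mulrCA -[X in _ - X]mul1r mulrC -mulrBl ler_wpM2r // lerBlDr.
  rewrite natr1 ler_pdivrMr // -natrM ler_nat.
  by rewrite ltnW // -ltn_divLR ?prime_gt0.
rewrite -(ler_pM2l N0R); lra.
Qed.

(** Partial summation in the form of an induction: the difference
    B(t) - A(t) / ln t, where A and B are the sums of ln p / p and 1 / p, changes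
    by A(t) (1 / ln t - 1 / ln (t + 1)), and
    1 - ln t / ln (t + 1) <= ln (ln (t + 1) / ln t). *)
Lemma mertens2 : exists C : R, forall t, (2 <= t)%N -> prime_inv_sum t <= ln (ln t%:R) + C.
Proof.
have l2 : 0 < ln (2 : R) by rewrite ln_gt0 // ltr1n.
have l4 : 0 < ln (4 : R) by rewrite ln_gt0 // ltr1n.
have lt0 t : (2 <= t)%N -> 0 < ln (t%:R : R) by move=> t2; rewrite ln_gt0 // ltr1n.
have step t : (2 <= t)%N -> prime_inv_sum t - prime_log_sum t / ln t%:R <=
    ln (ln t%:R) - ln (ln 2) + ln 4 * (1 / ln 2 - 1 / ln t%:R).
  elim: t => // t IH; rewrite leq_eqVlt => /predU1P[[<-]|t2].
    rewrite /prime_log_sum /prime_inv_sum !unlock /= !addr0.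
    rewrite !subrr mulr0 addr0.
    by rewrite mulrAC divff ?gt_eqF // mul1r subrr.
  have {}t2 : (2 <= t)%N by [].
  have {}IH := IH t2.
  have lt := lt0 t t2; have lt' := lt0 t.+1 (leqW t2).
  have tt : ln t%:R <= ln t.+1%:R :> R.
    by rewrite ler_ln ?posrE ?ltr0n ?ler_nat // (leq_trans _ t2).
  have -> : prime_inv_sum t.+1 - prime_log_sum t.+1 / ln t.+1%:R =
      prime_inv_sum t - prime_log_sum t / ln t.+1%:R.
    rewrite /prime_log_sum /prime_inv_sum !(big_mkcond prime).
    rewrite !(big_nat_recr t.+1) //= -!(big_mkcond prime) /=.
    case: ifP => _; last by rewrite !addr0.
    by field; rewrite (gt_eqF lt') nat1r pnatr_eq0.
  have At := mertens1 (ltnW t2).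
  set x := ln t%:R in IH lt tt At *; set y := ln t.+1%:R in lt' tt *.
  have xy : 0 <= 1 / x - 1 / y by rewrite subr_ge0 !div1r lef_pV2.
  have : prime_log_sum t * (1 / x - 1 / y) <= (x + ln 4) * (1 / x - 1 / y) by rewrite ler_wpM2r.
  have : x * (1 / x - 1 / y) <= ln y - ln x.
    rewrite -ln_div // mulrBr mulrCA divff ?gt_eqF // mulr1.
    have xy1 : 0 < y / x by rewrite divr_gt0.
    have := @le_ln1Dx R (x / y - 1).
    have xyp : 0 < x / y by rewrite divr_gt0.
    rewrite (_ : 1 + (x / y - 1) = x / y); last by ring.
    move=> /(_ _)/wrap[|H]; first lra.
    have : ln (y / x) = - ln (x / y) by rewrite -lnV ?posrE // invf_div.
    lra.
  lra.
exists (1 + ln 4 / ln 2 + ln 4 / ln 2 - ln (ln 2)) => t t2.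
have lt := lt0 t t2; have := step t t2.
have At := mertens1 (ltnW t2).
have : prime_log_sum t / ln t%:R <= 1 + ln 4 / ln t%:R.
  by rewrite ler_pdivrMr // mulrDl mul1r divfK // gt_eqF.
have : ln 4 / ln t%:R <= ln 4 / ln (2 : R).
  rewrite ler_wpM2l ?(ltW l4) // lef_pV2 // ler_ln ?posrE ?ltr0n ?ler_nat //.
  exact: leq_trans t2.
have : 0 <= ln 4 / ln (t%:R : R) by rewrite divr_ge0 // ltW.
lra.
Qed.

Lemma prod_primes_logn n : (0 < n)%N ->
  (\prod_(p <- primes n) p ^ logn p n)%N = n.
Proof.
by move=> n0; rewrite [RHS]prod_prime_decomp // prime_decompE big_map.
Qed.

Lemma totient_prod n : (0 < n)%N ->
  n%:R = (totient n)%:R * \prod_(p <- primes n) (p%:R / p.-1%:R) :> R.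
Proof.
move=> n0; rewrite totientE // -{1}(prod_primes_logn n0) !natr_prod -big_split.
rewrite /= !big_seq; apply: eq_bigr => p pn.
have p_pr : prime p by move: pn; rewrite mem_primes => /andP[].
rewrite natrM natrX -{1}(prednK (_ : 0 < logn p n)%N) ?logn_gt0 // natrX exprSr.
have : p.-1%:R != 0 :> R by have := prime_gt1 p_pr; rewrite pnatr_eq0; lia.
by move=> ?; field.
Qed.

Lemma sum_primes n M (F : nat -> R) : (n < M)%N ->
  \sum_(p <- primes n) F p = \sum_(0 <= p < M | p \in \pi(n)) F p.
Proof. by move=> nM; rewrite -(filter_pi_of nM) big_filter. Qed.

Lemma sum_inv_consecutive k :
  \sum_(2 <= m < k.+2) (m%:R * m.-1%:R)^-1 <= 1 - k.+1%:R^-1 :> R.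
Proof.
elim: k => [|k IH]; first by rewrite big_geq // invr1 subrr.
rewrite big_nat_recr //=; apply: le_trans (lerD IH (lexx _)) _.
rewrite -[k.+2%:R]natr1; set x : R := k.+1%:R.
have x0 : 0 < x by rewrite ltr0n.
rewrite le_eqVlt; apply/orP; left; apply/eqP; field.
by apply/andP; split; apply: lt0r_neq0; lra.
Qed.

Lemma ln3_gt1 : 1 < ln (3 : R).
Proof.
rewrite -[ltLHS]expRK ltr_ln ?posrE ?expR_gt0 //.
have e : 5 / 6 <= expR (- (1 / 6)) :> R.
  by apply: le_trans (expR_ge1Dx _); lra.
(* e <= (6/5)^6 < 3. *)
have e6 : expR 1 * expR (- (1 / 6)) ^+ 6 = 1 :> R.
  rewrite -expRM_natl -expRD (_ : 1 + 6%:R * - (1 / 6) = 0) ?expR0 //.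
  by field.
have : (5 / 6) ^+ 6 <= expR (- (1 / 6)) ^+ 6 :> R.
  by rewrite lerXn2r ?nnegrE ?expR_ge0 //; lra.
have := @expR_gt0 R 1.
set a := expR 1 in e6 *; set b := _ ^+ 6 in e6 * => a0 hb.
rewrite ltNge; apply/negP => a3.
have : 3 * (5 / 6) ^+ 6 <= a * b by apply: ler_pM => //; lra.
rewrite e6; lra.
Qed.

(** n / phi(n) is at most the exponential of the sum of 1 / (p - 1), which up to a
    constant is the sum of 1 / p.  The primes p <= Y with Y close to ln n
    contribute ln ln Y + O(1) by Mertens, the at most ln n / ln 2 larger ones O(1). *)
Lemma totient_lower_bound : exists C : R, 0 < C /\
  forall n, (3 <= n)%N -> n%:R <= C * (totient n)%:R * ln (ln n%:R).
Proof.
have [C1 BC1] := mertens2.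
have l2 : 0 < ln (2 : R) by rewrite ln_gt0 // ltr1n.
have l3 := ln3_gt1.
have l33 : 0 < ln (ln 3) :> R by rewrite ln_gt0.
pose C2 := expR (C1 + (ln 2)^-1 + 1) : R.
have C20 : 0 < C2 by exact: expR_gt0.
exists (C2 * (ln 3 / ln (ln 3) + 1)); split.
  by rewrite mulr_gt0 // addr_gt0 // divr_gt0 //; lra.
move=> n n3; have n0 : (0 < n)%N by lia.
have n0R : 0 < n%:R :> R by rewrite ltr0n.
have un : ln 3 <= ln n%:R :> R by rewrite ler_ln ?posrE ?ltr0n // ler_nat.
set u := ln n%:R in un *.
have u0 : 0 <= u by lra.
(* Larger than ln n, and at least 2 because ln 3 > 1. *)
pose Y := (Num.truncn u).+1.
have /andP[Yl Yu] := truncn_itv u0; rewrite -/Y in Yu.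
have Y2 : (2 <= Y)%N by rewrite /Y ltnS truncn_gt_nat /=; lra.
have lY : 0 < ln (Y%:R : R) by rewrite ln_gt0 // ltr1n.
have pr p : p \in primes n -> 0 < p%:R :> R /\ 0 < p.-1%:R :> R.
  rewrite mem_primes => /andP[/prime_gt1 p1 _]; rewrite !ltr0n; split; lia.
have step1 : \prod_(p <- primes n) (p%:R / p.-1%:R) <=
    expR (\sum_(p <- primes n) p.-1%:R^-1) :> R.
  rewrite expR_sum big_seq [leRHS]big_seq; apply: ler_prod => p /pr[p0 p10].
  rewrite divr_ge0 ?(ltW p0) ?(ltW p10) //=.
  apply: le_trans (expR_ge1Dx _).
  have e : p%:R = p.-1%:R + 1 :> R by rewrite natr1 prednK // -(ltr0n R).
  by rewrite e mulrDl divff ?gt_eqF // mul1r.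
have step2 : \sum_(p <- primes n) p.-1%:R^-1 =
    \sum_(p <- primes n) p%:R^-1 + \sum_(p <- primes n) (p%:R * p.-1%:R)^-1 :> R.
  rewrite -big_split /= !big_seq; apply: eq_bigr => p /pr[p0 p10].
  have e : p%:R = p.-1%:R + 1 :> R by rewrite natr1 prednK // -(ltr0n R).
  rewrite e in p0 *; field.
  by rewrite !gt_eqF.
have step3 : \sum_(p <- primes n) (p%:R * p.-1%:R)^-1 <= 1 :> R.
  rewrite (@sum_primes _ n.+2) //.
  apply: (@le_trans _ _ (\sum_(2 <= m < n.+2) (m%:R * m.-1%:R)^-1)); last first.
    by apply: le_trans (sum_inv_consecutive n) _; rewrite gerBl invr_ge0.
  rewrite (@big_nat_widenl _ _ _ 2 0) // [leLHS]big_mkcond [leRHS]big_mkcond.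
  apply: ler_sum => p _; rewrite /=; case: ifP => [pn|_].
    rewrite ifT // prime_gt1 //.
    by move: pn; rewrite mem_primes => /andP[].
  by case: ifP => // _; rewrite invr_ge0 mulr_ge0.
have step4 : \sum_(p <- primes n | (p <= Y)%N) p%:R^-1 <= prime_inv_sum Y.
  pose M := (maxn n Y).+1.
  rewrite -big_filter.
  have -> : [seq p <- primes n | (p <= Y)%N] =
     [seq p <- index_iota 0 M | (p \in \pi(n)) && (p <= Y)%N].
    by rewrite -(@filter_pi_of n M) ?ltnS ?leq_maxl // -filter_predI;
       apply: eq_filter => p /=; rewrite andbC.
  rewrite big_filter /prime_inv_sum (@big_nat_widen _ _ _ 0 Y.+1 M) ?ltnS ?leq_maxr //.
  rewrite [leLHS]big_mkcond [leRHS]big_mkcond; apply: ler_sum => p _.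
  case: ifP => [/andP[pn pY]|_].
    rewrite ifT // ltnS pY andbT.
    by move: pn; rewrite mem_primes => /andP[].
  by case: ifP => // _; rewrite invr_ge0.
have step5 : \sum_(p <- primes n | ~~ (p <= Y)%N) p%:R^-1 <= (ln 2)^-1 :> R.
  have Y0 : 0 < Y%:R :> R by rewrite ltr0n.
  apply: (@le_trans _ _ (\sum_(p <- primes n) Y%:R^-1)).
    rewrite big_mkcond; apply: ler_sum => p _; case: ifP => [|_]; last by rewrite invr_ge0.
    rewrite -ltnNge => Yp; rewrite lef_pV2 ?posrE ?ltr0n ?ler_nat //; first exact: ltnW.
    exact: leq_ltn_trans Yp.
  have sz : (2 ^ size (primes n) <= n)%N.
    have -> : (2 ^ size (primes n) = \prod_(p <- primes n) 2)%N.
      by rewrite big_const_seq count_predT iter_muln_1.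
    rewrite -[leqRHS](prod_primes_logn n0) !big_seq; apply: leq_prod => p pn.
    have p1 : (1 < p)%N by move: pn; rewrite mem_primes => /andP[/prime_gt1].
    by rewrite (leq_trans p1) // -{1}(expn1 p) leq_exp2l // logn_gt0.
  have : (size (primes n))%:R * ln 2 <= u.
    by rewrite mulr_natl -lnXn // ler_ln ?posrE ?exprn_gt0 // -natrX ler_nat.
  move=> H; rewrite big_const_seq count_predT iter_addr_0 -[leLHS]mulr_natl.
  rewrite ler_pdivrMr // mulrC ler_pdivlMr //; lra.
have tot : n%:R <= (totient n)%:R * (ln Y%:R * C2).
  rewrite (totient_prod n0) ler_wpM2l //; apply: le_trans step1 _.
  rewrite -[ln Y%:R]lnK ?posrE // /C2 -expRD ler_expR step2.
  rewrite (bigID (fun p => p <= Y)%N) /=.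
  have := BC1 Y Y2; lra.
have lnu : 0 < u by lra.
have lnY : ln Y%:R <= ln 3 + ln u.
  rewrite -lnM ?posrE // ler_ln ?posrE ?mulr_gt0 ?ltr0n //.
  by rewrite /Y -natr1; lra.
have lu : ln (ln 3) <= ln u by rewrite ler_ln ?posrE //; lra.
have : ln 3 <= ln 3 / ln (ln 3) * ln u.
  by rewrite mulrAC ler_pdivlMr // ler_wpM2l //; lra.
move=> H; apply: le_trans tot _.
rewrite [leRHS]mulrAC mulrC ler_wpM2r //.
rewrite mulrC -mulrA ler_wpM2l ?(ltW C20) //; lra.
Qed.

End Mertens.

(** * Fourth moment over all characters *)

Section Moments.
Variable R : realType.

Lemma harm_ln m : (0 < m)%N -> harm R m <= 1 + ln m%:R.
Proof.
elim: m => // -[_ _|m IH _].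
  by rewrite /harm big_nat1 invr1 ln1 addr0.
rewrite /harm big_nat_recr //=; apply: le_trans (lerD (IH isT) (lexx _)) _.
rewrite -addrA lerD2l.
set x : R := m.+1%:R; have x0 : 0 < x by rewrite ltr0n.
have -> : m.+2%:R = x + 1 by rewrite natr1.
have x1 : 0 < x + 1 by lra.
have xi : 0 < (x + 1)^-1 by rewrite invr_gt0.
have e : x / (x + 1) = 1 + - (x + 1)^-1 by field; apply: lt0r_neq0; lra.
have h : ln (x / (x + 1)) <= - (x + 1)^-1.
  rewrite e; apply: le_ln1Dx.
  by rewrite ltrN2 invf_lt1 //; lra.
by move: h; rewrite ln_div ?posrE //; lra.
Qed.

(** From 1 + x <= exp x at x = ln n / 64; here 64 = 4 * 16. *)
Lemma ln_pow4_le n y : (0 < n)%N -> (n < y.+1 ^ 16)%N ->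
  (1 + ln n%:R) ^+ 4 <= 64 ^+ 4 * y.+1%:R :> R.
Proof.
move=> n0 ny; set L := ln n%:R.
have n0R : 0 < n%:R :> R by rewrite ltr0n.
have L0 : 0 <= L by rewrite ln_ge0 // ler1n.
have e1 : 1 + L <= 64 * expR (L / 64).
  by have := expR_ge1Dx (L / 64); lra.
have e2 : expR (L / 64) ^+ 4 <= y.+1%:R.
  rewrite -(@ler_pXn2r _ 16) ?nnegrE ?exprn_ge0 ?expR_ge0 //.
  rewrite -exprM -expRM_natr (_ : L / 64 * (4 * 16)%:R = L); last by field.
  by rewrite lnK ?posrE // -natrX ler_nat ltnW.
apply: (@le_trans _ _ ((64 * expR (L / 64)) ^+ 4)).
  by rewrite lerXn2r ?nnegrE ?mulr_ge0 ?expR_ge0 //; lra.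
by rewrite exprMn ler_wpM2l // exprn_ge0.
Qed.

(** Take for y the integral part of the 16th root of n.  Then (1 + ln n)^4 is
    O(y), hence so is n / phi(n) times the cube of the harmonic sum, and the
    off-diagonal terms are under control because sqrt n * y^5 <= n / y^3. *)
Lemma primitive_moment_bound : exists K : R, 0 < K /\
  forall n (I : finType) (P : pred I) (chi : I -> nat -> R[i]),
  (1 < n)%N -> odd n -> dchar_family n P chi ->
  (forall i, P i -> primitive n (chi i)) ->
  \sum_(i | P i) normc (beta n (chi i)) ^+ 4
    <= K * (n%:R * (totient n)%:R ^+ 2).
Proof.
have [C [C0 tot]] := totient_lower_bound R.
pose D : R := 64 ^+ 4; have D0 : 0 < D by rewrite exprn_gt0.
exists (128 * (32 + 2 * (C * D) + C * D)); split.
  by have := mulr_gt0 C0 D0; lra.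
move=> n I P chi n1 oddn fam prim.
have n3 : (3 <= n)%N by lia.
have n0 : (0 < n)%N by lia.
have ex : exists y, (y ^ 16 <= n)%N by exists 0%N.
have bd y : (y ^ 16 <= n)%N -> (y <= n)%N.
  by move=> h; apply: leq_trans h; case: y => // y; exact: (@leq_pexp2l y.+1 1 16).
case: (ex_maxnP ex bd) => y yn ymax.
have y1 : (0 < y)%N by apply: ymax; rewrite exp1n.
have ny : (n < y.+1 ^ 16)%N by rewrite ltnNge; apply/negP => /ymax; rewrite ltnn.
have yh : (y <= n./2)%N.
  have [y2|y2] := leqP y 1; first by lia.
  have : (y ^ 2 <= n)%N by apply: leq_trans yn; rewrite leq_exp2l.
  by rewrite expnS expn1; nia.
apply: le_trans (primitive_moment fam n1 oddn yh prim) _.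
set f : R := (totient n)%:R; have f0 : 0 < f by rewrite ltr0n totient_gt0.
have n0R : 0 < n%:R :> R by rewrite ltr0n.
set L : R := 1 + ln n%:R.
have l0 : 0 <= ln n%:R :> R by rewrite ln_ge0 // ler1n.
have L1 : 1 <= L by rewrite lerDl.
have L4 : L ^+ 4 <= D * y.+1%:R := ln_pow4_le n0 ny.
have nL : n%:R <= C * f * L.
  apply: le_trans (tot n n3) _; rewrite ler_wpM2l ?mulr_ge0 ?ltW //.
  have ln0 : 0 < ln n%:R :> R by rewrite ln_gt0 // ltr1n.
  by rewrite /L; have := ln_sublinear ln0; lra.
have Y0 : 0 < y.+1%:R :> R by rewrite ltr0n.
have H0 : 0 <= harm R n := harm_ge0 R n.
have HL : harm R n <= L := harm_ln n0.
have T : n%:R * (harm R n ^+ 3 / y.+1%:R) <= C * D * f.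
  rewrite mulrA ler_pdivrMr //.
  apply: (@le_trans _ _ (C * f * L * L ^+ 3)).
    apply: ler_pM => //; first exact: exprn_ge0.
    by rewrite lerXn2r ?nnegrE //; lra.
  rewrite -mulrA -exprS.
  have := ler_wpM2l (ltW (mulr_gt0 C0 f0)) L4; lra.
have S : Num.sqrt n%:R * y%:R ^+ 5 <= 2 * (C * D) * f.
  have yR : 1 <= y%:R :> R by rewrite ler1n.
  have y3 : 0 < y%:R ^+ 3 :> R by rewrite exprn_gt0 //; lra.
  rewrite -(ler_pM2r y3) (_ : _ * y%:R ^+ 5 * _ = Num.sqrt n%:R * y%:R ^+ 8);
    last by rewrite -mulrA -exprD.
  have s8 : y%:R ^+ 8 <= Num.sqrt n%:R :> R.
    rewrite -[leLHS]ger0_norm ?exprn_ge0 // -sqrtr_sqr ler_wsqrtr // -exprM.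
    by rewrite -natrX ler_nat.
  have sn : Num.sqrt n%:R * y%:R ^+ 8 <= n%:R :> R.
    rewrite -[leRHS]sqr_sqrtr // expr2 ler_wpM2l ?sqrtr_ge0 //.
  apply: le_trans sn _; apply: le_trans nL _.
  have LL : L <= D * y.+1%:R.
    by apply: le_trans L4; rewrite -[leLHS]expr1 ler_weXn2l.
  have yy : y.+1%:R <= 2 * y%:R ^+ 3 :> R.
    rewrite -natr1; have : y%:R <= y%:R ^+ 3 :> R by rewrite -[leLHS]expr1 ler_weXn2l.
    lra.
  have := ler_wpM2l (ltW (mulr_gt0 C0 f0)) LL.
  have := ler_wpM2l (ltW (mulr_gt0 (mulr_gt0 C0 f0) D0)) yy.
  lra.
have nf : 0 <= n%:R * f by rewrite mulr_ge0 // ltW.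
have := ler_wpM2l nf T; have := ler_wpM2l nf S; 
  set iy := y.+1%:R^-1; lra.
Qed.

Lemma totient_mul_dvd p q : (0 < q)%N -> prime p -> (p %| q)%N ->
  (totient (p * q))%:R = p%:R * (totient q)%:R :> R.
Proof.
move=> q0 p_pr pq; have p0 := prime_gt0 p_pr.
have pE : primes (p * q) = primes q.
  apply/eq_primes => r; rewrite primesM // primes_prime // inE.
  by case: eqP => // ->; rewrite mem_primes p_pr q0 pq.
have := totient_prod R (_ : 0 < p * q)%N; rewrite muln_gt0 p0 q0 => /(_ isT).
rewrite pE natrM {1}(totient_prod R q0) mulrA => /mulIf -> //.
rewrite prodf_seq_neq0; apply/allP => r; rewrite mem_primes => /andP[/prime_gt1 r1 _].
apply/implyP => _; rewrite mulf_neq0 ?invr_eq0 ?pnatr_eq0 //; lia.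
Qed.

(** The loss 16 divided by the gain p (p - 1)^2; for p = 3 part of the loss is
    carried by [three_weight]. *)
Definition descent_weight p : R :=
  if p == 3%N then 3^-1 else 16 / (p%:R * p.-1%:R ^+ 2).

(** With p = 2 x + 1 the weight 4 / (x^2 (2 x + 1)) is below the telescoping
    difference of 1 / ((x - 1) x) and 1 / (x (x + 1)); the primes p >= 5 add up to
    at most 1/2, and p = 3 adds 1/3. *)
Lemma descent_weight_sum n : odd n ->
  \sum_(p <- primes n) descent_weight p <= 5 / 6.
Proof.
move=> oddn; have n0 : (0 < n)%N by lia.
have w0 p : 0 <= descent_weight p.
  rewrite /descent_weight; case: ifP => _; first by rewrite invr_ge0.
  by rewrite divr_ge0 // mulr_ge0 ?sqr_ge0.
have S N : \sum_(0 <= p < N.*2.+4 | odd p && (2 < p)%N) descent_weight p <=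
    5 / 6 - (N.+1%:R * N.+2%:R)^-1.
  elim: N => [|N IH].
    by rewrite unlock /= /descent_weight /=; lra.
  rewrite doubleS big_mkcond big_nat_recr // big_nat_recr //= -big_mkcond /=.
  rewrite odd_double /= addr0.
  apply: le_trans (lerD IH (lexx _)) _.
  rewrite /descent_weight /=.
  have -> : N.*2.+4%:R = 2 * N.+2%:R :> R by rewrite -natrM; congr _%:R; lia.
  have -> : N.*2.+4.+1%:R = 2 * N.+2%:R + 1 :> R by rewrite -natrM natr1; congr _%:R; lia.
  have -> : N.+3%:R = N.+2%:R + 1 :> R by rewrite natr1.
  have -> : N.+1%:R = N.+2%:R - 1 :> R by rewrite -[N.+2%:R]natr1 addrK.
  have : 2 <= N.+2%:R :> R by rewrite ler_nat.
  set x := N.+2%:R => x2.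
  rewrite -addrA lerD2l -subr_ge0.
  have -> : - (x * (x + 1))^-1 - (- ((x - 1) * x)^-1 + 16 / ((2 * x + 1) * (2 * x) ^+ 2))
     = (2 * x + 4) / ((x - 1) * x ^+ 2 * (x + 1) * (2 * x + 1)).
    field.
    by do !(apply/andP; split); apply: lt0r_neq0; lra.
  rewrite divr_ge0 ?mulr_ge0 ?sqr_ge0 //; lra.
have H (x : R) : x <= 5 / 6 - (n.+1%:R * n.+2%:R)^-1 -> x <= 5 / 6.
  have : 0 <= (n.+1%:R * n.+2%:R : R)^-1 by rewrite invr_ge0 mulr_ge0.
  by set z := (_ * _)^-1; lra.
apply: H; apply: le_trans (S n).
rewrite (@sum_primes R n n.*2.+4); last by lia.
rewrite [leLHS]big_mkcond [leRHS]big_mkcond; apply: ler_sum => p _.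
case: ifP => [|_]; last by case: ifP.
rewrite mem_primes => /and3P[p_pr _ pn].
have op : odd p by apply: dvdn_odd pn oddn.
rewrite op ifT //=; have := prime_gt1 p_pr.
by case: p op {p_pr pn} => [|[|[|]]].
Qed.

(** For p = 3 not dividing q the loss 16 exceeds the gain 3 * 2^2; the jump from 1
    to 4 covers the difference. *)
Definition three_weight n : R := if (3 %| n)%N then 4 else 1.

Lemma descent_factor p q : prime p -> odd (p * q) -> (0 < q)%N ->
  (if (p %| q)%N then 1 else 2) ^+ 4 *
    (three_weight q * (q%:R * (totient q)%:R ^+ 2)) <=
  descent_weight p *
    (three_weight (p * q) * ((p * q)%:R * (totient (p * q))%:R ^+ 2)).
Proof.
move=> p_pr opq q0; have p3 := odd_prime_gt2 p_pr opq.
set f : R := (totient q)%:R.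
have X0 : 0 <= q%:R * f ^+ 2 by rewrite mulr_ge0 ?sqr_ge0.
have p1E : p.-1%:R = p%:R - 1 :> R.
  by rewrite -[in RHS](prednK (prime_gt0 p_pr)) -natr1 addrK.
have pR : 3 <= p%:R :> R by rewrite ler_nat.
have tE : (totient (p * q))%:R = (if (p %| q)%N then p%:R else p%:R - 1) * f.
  case: ifP => pq; first exact: totient_mul_dvd.
  by rewrite totient_coprime ?prime_coprime ?pq // totient_prime // natrM p1E.
rewrite tE natrM.
have tw : three_weight q <= three_weight (p * q).
  rewrite /three_weight; case: ifP => q3; first by rewrite dvdn_mull.
  by case: ifP => _; lra.
have tw0 : 1 <= three_weight q by rewrite /three_weight; case: ifP; lra.
have gen (c d w : R) : c * three_weight q <= w * three_weight (p * q) * (p%:R * d ^+ 2) ->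
  c * (three_weight q * (q%:R * f ^+ 2)) <=
  w * (three_weight (p * q) * (p%:R * q%:R * (d * f) ^+ 2)).
  by move=> /(ler_wpM2r X0); lra.
apply: gen; rewrite /descent_weight.
have [p_3|p_n3] := eqVneq p 3.
  rewrite p_3 /three_weight dvdn_mulr //.
  by case: ifP => _; lra.
have p5 : 5 <= p%:R :> R.
  rewrite ler_nat; move: p_pr p3 p_n3; clear.
  by case: p => [|[|[|[|[|]]]]].
have -> : three_weight (p * q) = three_weight q.
  by rewrite /three_weight Euclid_dvdM // (@dvdn_prime2 3 p) // eq_sym (negPf p_n3).
rewrite p1E; set x := p%:R in pR p5 *; set t := three_weight q in tw0 *.
case: ifP => _; rewrite ?expr1n.
  rewrite (_ : 16 / (x * (x - 1) ^+ 2) * t * (x * x ^+ 2) =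
    t * (16 * (x / (x - 1)) ^+ 2)); last first.
    by field; apply/andP; split; apply: lt0r_neq0; lra.
  rewrite mulrC ler_wpM2l //; first lra.
  have : 1 <= x / (x - 1) by rewrite ler_pdivlMr; lra.
  move=> h; have := exprn_ege1 2 h; set z := _ ^+ 2; lra.
rewrite (_ : 16 / (x * (x - 1) ^+ 2) * t * (x * (x - 1) ^+ 2) = 16 * t); last first.
  by field; apply/andP; split; apply: lt0r_neq0; lra.
by rewrite ler_wpM2r //; lra.
Qed.

(** A character is primitive or induced from n/p for some prime p; the induced
    ones are counted for every such p.  The induction closes because the
    weights of these p add up to at most 5/6 < 1. *)
Lemma fourth_moment : exists K : R, 0 < K /\
  forall n (I : finType) (P : pred I) (chi : I -> nat -> R[i]),
  odd n -> dchar_family n P chi ->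
  (forall i, P i -> nontrivial n (chi i)) ->
  \sum_(i | P i) normc (beta n (chi i)) ^+ 4
    <= K * (three_weight n * (n%:R * (totient n)%:R ^+ 2)).
Proof.
have [K0 [K00 pm]] := primitive_moment_bound.
exists (6 * K0); split => [|n]; first lra.
have [m] := ubnP n; elim: m n => // m IH n le_nm I P chi oddn fam nt.
have n0 : (0 < n)%N by lia.
have X0 : 0 <= n%:R * (totient n)%:R ^+ 2 :> R by rewrite mulr_ge0 ?sqr_ge0.
have tw1 k : 1 <= three_weight k by rewrite /three_weight; case: ifP; lra.
have T0 : 0 <= 6 * K0 * (three_weight n * (n%:R * (totient n)%:R ^+ 2)).
  by rewrite !mulr_ge0 ?sqr_ge0 //; have := tw1 n; lra.
case: (pickP P) => [i0 Pi0|P0]; last by rewrite big_pred0.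
have n1 := nontrivial_gt1 (fam.1 _ Pi0) n0 (nt _ Pi0).
pose Fb i := normc (beta n (chi i)) ^+ 4.
have Fb0 i : 0 <= Fb i by rewrite exprn_ge0 ?normc_ge0.
apply: (@le_trans _ _ (\sum_(i | P i && primitive n (chi i)) Fb i +
  \sum_(p <- primes n) \sum_(i | P i && induced_from p (n %/ p) (chi i)) Fb i)).
  under [X in _ + X]eq_bigr do rewrite big_mkcondr.
  rewrite exchange_big big_mkcondr -big_split /=; apply: ler_sum => i Pi.
  case: ifPn => [_|]; first by rewrite lerDl; apply: sumr_ge0 => p _; case: ifP.
  case/allPn => p pn; rewrite negbK => ind; rewrite add0r.
  rewrite (big_rem p) //= ind lerDl; apply: sumr_ge0 => r _; by case: ifP.
have prim_part : \sum_(i | P i && primitive n (chi i)) Fb i <=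
    K0 * (three_weight n * (n%:R * (totient n)%:R ^+ 2)).
  apply: (@le_trans _ _ (K0 * (n%:R * (totient n)%:R ^+ 2))).
    apply: pm => // [|i /andP[]//]; split => [i /andP[Pi _]|i j /andP[Pi _] /andP[Pj _]].
      exact: fam.1.
    exact: fam.2.
  by rewrite ler_wpM2l ?(ltW K00) // ler_peMl.
have old_part p : p \in primes n ->
    \sum_(i | P i && induced_from p (n %/ p) (chi i)) Fb i <=
    descent_weight p * (6 * K0 * (three_weight n * (n%:R * (totient n)%:R ^+ 2))).
  rewrite mem_primes => /and3P[p_pr _ pn]; set q := (n %/ p)%N.
  have nE : n = (p * q)%N by rewrite /q mulnC divnK.
  have q0 : (0 < q)%N by rewrite divn_gt0 ?prime_gt0 // dvdn_leq.
  have p2 := prime_gt1 p_pr.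
  have qm : (q < m)%N by nia.
  have oq : odd q by move: oddn; rewrite nE oddM => /andP[].
  pose c : R := if (p %| q)%N then 1 else 2.
  have D i : P i -> dchar (p * q) (chi i) by rewrite -nE; exact: fam.1.
  have IHq := IH q qm I (fun i => P i && induced_from p q (chi i))
    (fun i => lower p q (chi i)) oq.
  have fq : dchar_family q (fun i => P i && induced_from p q (chi i))
      (fun i => lower p q (chi i)).
    split => [i /andP[Pi ind]|i j /andP[Pi _] /andP[Pj _] ij].
      exact: lower_dchar p_pr q0 (D i Pi) ind.
    have [a ne] := fam.2 i j Pi Pj ij; exists a => e; apply: ne.
    by rewrite (lower_eq p_pr (D i Pi)) (lower_eq p_pr (D j Pj)) e.
  have {IHq} := IHq fq _ => /(_ _)/wrap[i /andP[Pi _]|IHq].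
    by apply: nontrivial_lower p_pr _; rewrite -nE; exact: nt.
  apply: (@le_trans _ _ (c ^+ 4 * \sum_(i | P i && induced_from p q (chi i))
      normc (beta q (lower p q (chi i))) ^+ 4)).
    rewrite mulr_sumr; apply: ler_sum => i /andP[Pi ind].
    rewrite -exprMn lerXn2r ?nnegrE ?mulr_ge0 ?normc_ge0 //; first by rewrite /c; case: ifP.
    by rewrite nE; exact: beta_lower_le p_pr q0 (D i Pi) ind.
  have c4 : 0 <= c ^+ 4 by rewrite exprn_ge0 // /c; case: ifP.
  apply: le_trans (ler_wpM2l c4 IHq) _.
  have := @descent_factor p q p_pr _ q0; rewrite -nE => /(_ oddn).
  rewrite -/c => /(ler_wpM2l (_ : 0 <= 6 * K0))-/(_ _)/wrap[|]; first lra.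
  lra.
have old_sum : \sum_(p <- primes n)
    \sum_(i | P i && induced_from p (n %/ p) (chi i)) Fb i <=
    5 / 6 * (6 * K0 * (three_weight n * (n%:R * (totient n)%:R ^+ 2))).
  apply: le_trans (ler_wpM2r T0 (descent_weight_sum oddn)).
  by rewrite mulr_suml !big_seq; apply: ler_sum.
lra.
Qed.

End Moments.

(** * Character sums and the theorem *)

Section Assembly.
Variable R : realType.
Implicit Types (n k m : nat).

Lemma dchar_sum_nontrivial n (chi : nat -> R[i]) :
  dchar n chi -> (0 < n)%N -> nontrivial n chi -> \sum_(a < n) chi a = 0.
Proof.
move=> chiD n0 [u un cu]; set T := \sum_(_ < _) _.
have : chi u * T = T.
  rewrite /T -[RHS](big_unit_mul chi n0 un) mulr_sumr; apply: eq_bigr => a _.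
  by case: chiD => _ cM cm _; rewrite cm cM.
move/eqP; rewrite -subr_eq0 -{2}[T]mul1r -mulrBl mulf_eq0 subr_eq0.
by rewrite (negPf cu) => /eqP.
Qed.

Definition moment n (chi : nat -> R[i]) : R[i] := \sum_(a < n.+1) a%:R * chi a.

Lemma momentE n (chi : nat -> R[i]) : dchar n chi -> (1 < n)%N ->
  moment n chi = n%:R * beta n chi + n%:R / 2 * \sum_(a < n) chi a.
Proof.
move=> chiD n1; have nR : n%:R != 0 :> R by rewrite pnatr_eq0; lia.
rewrite /moment big_ord_recr /=.
have -> : chi n = 0.
  by case: chiD => _ _ _ ->; rewrite // /coprime gcdnn; lia.
rewrite mulr0 addr0 !mulr_sumr -big_split; apply: eq_bigr => a _ /=.
rewrite mulrA -mulrDl; congr (_ * _).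
have -> : n%:R / 2 = (n%:R / 2 : R)%:C by rewrite rmorphM fmorphV !rmorph_nat.
rewrite -(rmorph_nat (real_complex R) a) -(rmorph_nat (real_complex R) n).
by rewrite -rmorphM -rmorphD /=; congr (_%:C); field.
Qed.

(** The sawtooth is odd under a -> n - a. *)
Lemma beta_trivial n (chi : nat -> R[i]) : dchar n chi -> (1 < n)%N ->
  (forall a, coprime a n -> chi a = 1) -> beta n chi = 0.
Proof.
move=> chiD n1 triv; have nR : n%:R != 0 :> R by rewrite pnatr_eq0; lia.
have c0 a : ~~ coprime a n -> chi a = 0 by case: chiD => _ _ _; apply.
pose f a : R[i] := (a%:R / n%:R - 2^-1 : R)%:C * chi a.
have E : beta n chi = \sum_(1 <= a < n) f a.
  rewrite /beta -(big_mkord xpredT f) big_ltn ?(ltnW n1) // /f (c0 0%N) ?mulr0 ?add0r //.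
  by rewrite /coprime gcd0n; lia.
have opp : beta n chi = - beta n chi.
  rewrite {1}E big_nat_rev E -sumrN big_nat [RHS]big_nat.
  apply: eq_bigr => a /andP[a1 an]; rewrite /f.
  rewrite (_ : 1 + n - a.+1 = n - a)%N; last by lia.
  have -> : chi (n - a)%N = chi a.
    have cE : coprime (n - a) n = coprime a n.
      have := subnK (ltnW an); move: (n - a)%N => b <-.
      by rewrite /coprime gcdnDl gcdnDr gcdnC.
    have [ca|na] := boolP (coprime a n); first by rewrite !triv ?cE.
    by rewrite !c0 ?cE.
  rewrite -mulNr -rmorphN; congr (_%:C * _).
  by rewrite natrB ?(ltnW an) //; field.
have : beta n chi *+ 2 = 0 by rewrite mulr2n {1}opp addNr.
by move/eqP; rewrite mulrn_eq0 => /eqP.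
Qed.

(** Expand the k-th power and sum over characters first: column orthogonality
    selects the tuples whose product is m, and these consist of units. *)
Lemma S_sum_moments k n m (I : finType) (chi : I -> nat -> R[i]) :
  (1 < n)%N -> coprime m n -> dchar_family n xpredT chi -> #|I| = totient n ->
  (totient n)%:R * (S_sum k n m)%:R =
    \sum_i (chi i m)^* * moment n (chi i) ^+ k.
Proof.
move=> n1 mn fam cI; have n0 := ltnW n1.
have chiX i (f : {ffun 'I_k -> 'I_n.+1}) :
    \prod_(j < k) chi i (f j) = chi i (\prod_(j < k) f j)%N.
  have [c1 cM _ _] := fam.1 i isT.
  by elim/big_rec2: _ => [|j y x _ ->]; rewrite ?c1 ?cM.
transitivity (\sum_(f : {ffun 'I_k -> 'I_n.+1})
   (\prod_(j < k) f j)%N%:R *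
   \sum_i (chi i m)^* * chi i (\prod_(j < k) f j)%N); last first.
  under eq_bigr do rewrite mulr_sumr.
  rewrite exchange_big; apply: eq_bigr => i _ /=.
  rewrite -[k in RHS](card_ord k) -prodr_const /moment.
  rewrite bigA_distr_bigA /= mulr_sumr; apply: eq_bigr => f _.
  by rewrite big_split /= chiX natr_prod; ring.
rewrite /S_sum natr_sum mulr_sumr big_mkcond /=; apply: eq_bigr => f _.
rewrite (dchar_column_orth _ n0 fam cI mn).
set x := (\prod_(j < k) f j)%N.
have [xm|_] := boolP (x == m %[mod n])%N; last by rewrite andbF mulr0.
rewrite andbT ifT; first by rewrite mulrC.
have xn : coprime x n by rewrite -coprime_modl (eqP xm) coprime_modl.
apply/forallP => j; have jn : coprime (f j) n.
  by move: xn; rewrite /x (bigD1 j) //= coprimeMl => /andP[].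
rewrite jn andbT lt0n; apply: contraTneq jn => ->.
by rewrite /coprime gcd0n; lia.
Qed.

(** The principal character contributes the main term exactly; it occurs once
    because the sum of all chi(a) over a and chi equals phi(n). *)
Lemma error_moments k n m : (0 < k)%N -> (1 < n)%N -> coprime m n -> odd n ->
  exists (I : finType) (P : pred I) (chi : I -> nat -> R[i]),
  [/\ dchar_family n P chi, forall i, P i -> nontrivial n (chi i) &
   `| (S_sum k n m)%:R - main_term R k n | <=
     (totient n)%:R^-1 * (n%:R ^+ k * \sum_(i | P i) normc (beta n (chi i)) ^+ k) ].
Proof.
move=> k1 n1 mn oddn; have n0 := ltnW n1.
have [I [chi [fam cI]]] := dchar_complete_family R n1.
have chiD i : dchar n (chi i) by exact: fam.1.
pose triv i := [forall a : 'I_n, coprime a n ==> (chi i a == 1)].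
have trivP i : triv i -> forall a, coprime a n -> chi i a = 1.
  move=> /forallP H a an; have := H (Ordinal (ltn_pmod a n0)).
  rewrite /= coprime_modl an /= => /eqP <-; by case: (chiD i).
have ntP i : ~~ triv i -> nontrivial n (chi i).
  rewrite negb_forall => /existsP[a]; rewrite negb_imply => /andP[an ca].
  by exists a.
exists I, (fun i => ~~ triv i), chi; split => //.
  by split => [i _|i j _ _]; [exact: chiD | exact: fam.2].
pose f : R := (totient n)%:R.
have f0 : 0 < f by rewrite ltr0n totient_gt0.
have fC : (totient n)%:R = f%:C :> R[i] by rewrite rmorph_nat.
have f0C : f%:C != 0 :> R[i] by rewrite -fC pnatr_eq0 -lt0n totient_gt0.
have sumtriv i : triv i -> \sum_(a < n) chi i a = f%:C.
  move=> ti; rewrite -fC -(dchar_sum_sqr (chiD i) n0); apply: eq_bigr => a _.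
  have [an|na] := boolP (coprime a n); first by rewrite (trivP i) // conjC1 mulr1.
  by case: (chiD i) => _ _ _ ->; rewrite // mul0r.
have ntriv : \sum_(i | triv i) (1 : R[i]) = 1.
  apply: (@mulIf _ f%:C) => //; rewrite mul1r mulr_suml.
  transitivity (\sum_i \sum_(a < n) (chi i 1%N)^* * chi i a).
    rewrite big_mkcond /=; apply: eq_bigr => i _; rewrite -mulr_sumr.
    have -> : (chi i 1%N)^* = 1 by case: (chiD i) => ->; rewrite conjC1.
    rewrite !mul1r; case: ifPn => ti; first by rewrite sumtriv.
    by rewrite (dchar_sum_nontrivial (chiD i) n0 (ntP i ti)).
  rewrite exchange_big /=.
  under eq_bigr do rewrite (dchar_column_orth _ n0 fam cI (coprime1n n)).
  rewrite -big_mkcond /= (big_pred1 (Ordinal n1)) => [|a]; first by rewrite fC.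
  by rewrite /= -val_eqE /= !modn_small.
have sum_triv (x : R[i]) : \sum_(i | triv i) x = x.
  rewrite -[RHS]mul1r -ntriv mulr_suml; apply: eq_bigr => i _.
  by rewrite mul1r.
pose T := \sum_(i | ~~ triv i) (chi i m)^* * moment n (chi i) ^+ k.
have key : f%:C * (S_sum k n m)%:R = (n%:R / 2 * f%:C) ^+ k + T.
  rewrite -fC (S_sum_moments _ n1 mn fam cI) (bigID triv) /= -/T; congr (_ + T).
  rewrite -[RHS]sum_triv; apply: eq_bigr => i ti.
  rewrite (trivP i ti m mn) conjC1 mul1r.
  by rewrite momentE // sumtriv // (beta_trivial (chiD i) n1 (trivP i ti)) mulr0 add0r fC.
have main : f%:C * (main_term R k n)%:C = (n%:R / 2 * f%:C) ^+ k.
  have -> : n%:R / 2 = (n%:R / 2 : R)%:C by rewrite rmorphM fmorphV !rmorph_nat.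
  rewrite -!rmorphM -rmorphXn; congr (_%:C); rewrite /main_term -/f.
  have -> : (n%:R / 2 * f) ^+ k = n%:R ^+ k * 2 ^- k * (f * f ^+ k.-1).
    by rewrite -exprS prednK // !exprMn exprVn.
  by rewrite subn1; ring.
have TE : T = (f * ((S_sum k n m)%:R - main_term R k n))%:C.
  rewrite rmorphM rmorphB /= mulrBr main (rmorph_nat _ (S_sum k n m)) key; ring.
have nT : normc T = f * `|(S_sum k n m)%:R - main_term R k n|.
  by rewrite TE normc_real normrM ger0_norm // ltW.
rewrite mulrC ler_pdivlMr // mulrC -nT.
apply: le_trans (normc_sum _ _ _) _; rewrite mulr_sumr; apply: ler_sum => i ti.
rewrite normcM normc_conj (dchar_norm (chiD i)) // mul1r.
rewrite momentE // (dchar_sum_nontrivial (chiD i) n0 (ntP i ti)) mulr0 addr0.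
by rewrite normcX normcM normc_nat exprMn.
Qed.

End Assembly.

Theorem theorem2 (R : realType) (k : nat) (hk : (4 <= k)%N) :
  exists C : R, 0 < C /\
    forall n m : nat, (3 <= n)%N -> odd n -> (1 <= m)%N -> coprime m n ->
      `| (S_sum k n m)%:R - main_term R k n | <= C * error_term R k n.
Proof.
have [C [C0 tot]] := totient_lower_bound R.
have [K [K0 fourth]] := fourth_moment R.
rewrite -(subnK hk); move: (k - 4)%N => j {k hk}.
exists (4 * K * 8 ^+ j * C ^+ 2); split.
  by rewrite !mulr_gt0 ?exprn_gt0.
move=> n m n3 oddn _ mn.
have n1 : (1 < n)%N by lia.
have n0 : (0 < n)%N by lia.
have n0R : 0 < n%:R :> R by rewrite ltr0n.
have [I [P [chi [fam nt]]]] := error_moments R (k := j + 4)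
  (ltn_addl j (isT : 0 < 4)%N) n1 mn oddn.
move/le_trans; apply.
set f : R := (totient n)%:R; have f0 : 0 < f by rewrite ltr0n totient_gt0.
set l : R := ln n%:R; set s : R := Num.sqrt n%:R.
have s0 : 0 <= s by exact: sqrtr_ge0.
have sn : s ^+ 2 = n%:R by rewrite sqr_sqrtr ?ler0n.
have l1 : 1 <= l.
  apply: le_trans (ltW (ln3_gt1 R)) _.
  by rewrite ler_ln ?posrE ?ltr0n // ler_nat.
(* The weight at most 2, two harmonic sums, and 1 + l <= 2 l. *)
pose M := 8 * s * l.
have sup i : P i -> normc (beta n (chi i)) <= M.
  move=> Pi; apply: le_trans (polya_vinogradov oddn (fam.1 i Pi) (nt i Pi)) _.
  have h := harm_ln R n0; rewrite -/l in h; have h0 := harm_ge0 R n.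
  apply: (@le_trans _ _ (2 * s * (2 * harm R n))).
    by rewrite -!mulrA ler_wpM2r ?mulr_ge0 //; case: ifP; lra.
  rewrite /M -mulrA [8 * s]mulrC; have := ler_wpM2l s0 h; have := ler_wpM2l s0 l1; lra.
have sum_le : \sum_(i | P i) normc (beta n (chi i)) ^+ (j + 4) <=
    M ^+ j * (K * (4 * (n%:R * f ^+ 2))).
  apply: (@le_trans _ _ (M ^+ j * \sum_(i | P i) normc (beta n (chi i)) ^+ 4)).
    rewrite mulr_sumr; apply: ler_sum => i Pi; rewrite exprD.
    rewrite ler_wpM2r ?exprn_ge0 ?normc_ge0 // lerXn2r ?nnegrE ?normc_ge0 ?sup //.
    by rewrite !mulr_ge0 //; lra.
  rewrite ler_wpM2l ?exprn_ge0 ?mulr_ge0 //; first lra.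
  apply: le_trans (fourth n I P chi oddn fam nt) _.
  rewrite ler_wpM2l ?(ltW K0) // ler_wpM2r ?mulr_ge0 ?sqr_ge0 //.
  by rewrite /three_weight; case: ifP; lra.
have pw : n%:R `^ (3 / 2 * ((j + 4)%:R - 2)) = s ^+ (3 * (j + 2)) :> R.
  rewrite (_ : 3 / 2 * _ = 2^-1 * (3 * (j + 2))%:R); last first.
    by rewrite natrM !natrD; field.
  by rewrite powRrM powR12_sqrt ?ler0n // powR_mulrn.
rewrite /error_term pw addnK -/f -/l.
set ll : R := ln l.
have nn : n%:R ^+ 2 <= (C * f * ll) ^+ 2.
  by rewrite lerXn2r ?nnegrE ?tot ?ler0n // (le_trans _ (tot n n3)).
have W0 : 0 <= 4 * K * 8 ^+ j * l ^+ j * f * s ^+ (3 * (j + 2)).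
  by rewrite !mulr_ge0 ?exprn_ge0 ?(ltW K0) ?(ltW f0) //; lra.
apply: (@le_trans _ _ (4 * K * 8 ^+ j * l ^+ j * f * s ^+ (3 * (j + 2)) * n%:R ^+ 2)).
  apply: (@le_trans _ _ (f^-1 * (n%:R ^+ (j + 4) * (M ^+ j * (K * (4 * (n%:R * f ^+ 2))))))).
    by rewrite ler_wpM2l ?invr_ge0 ?(ltW f0) // ler_wpM2l ?exprn_ge0.
  rewrite le_eqVlt; apply/orP; left; apply/eqP.
  rewrite /M !exprMn -sn (_ : 3 * (j + 2) = j + j + j + 6)%N; last by lia.
  rewrite !exprD -!exprM !(mulnC 2) !exprM; field.
  exact: lt0r_neq0.
have := ler_wpM2l W0 nn; rewrite !exprMn; lra.
Qed.
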